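(* Let $I,J,M,N\subseteq\{1,\dots,n\}$ with $|I|=|J|$ and $|M|=|N|$. Then in $A=\mathcal{O}_q(M_n(k))$, $$q^{|I\cap M|}[I|J][M|N]+q^{|I\cap M|}\sum_{S\in\{>J\Vert N\}}\widetilde{\mu}_S\,[I|S][M|S^\natural]=q^{|J\cap N|}[M|N][I|J]+q^{|J\cap N|}\sum_{T\in\{<I\Vert M\}}\widetilde{\lambda}_T\,[T^\natural|N][T|J],$$ where $S^\natural=S^\natural_{J,N}$, $T^\natural=T^\natural_{I,M}$, and $$\widetilde{\mu}_S=(-\widehat{q})^{|S\setminus J|}(-q)^{-\mathcal{L}^\natural(S,J,N)}\xi_q(S\setminus J;J\setminus S),\qquad \widetilde{\lambda}_T=(-\widehat{q})^{|I\setminus T|}(-q)^{-\mathcal{L}(T,I,M)}\xi_q(I\setminus T;T\setminus I)$$ for $S\in\{>J\Vert N\}$ and $T\in\{<I\Vert M\}$.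
   Context: Let $k$ be a field, $n$ a positive integer, $q\in k^\times$, and $\widehat{q}=q-q^{-1}$. The algebra $A=\mathcal{O}_q(M_n(k))$ is the $k$-algebra with generators $X_{ij}$ ($1\le i,j\le n$) and relations: $X_{ij}X_{lj}=qX_{lj}X_{ij}$ for $i<l$; $X_{ij}X_{im}=qX_{im}X_{ij}$ for $j<m$; $X_{ij}X_{lm}=X_{lm}X_{ij}$ for $i<l$, $j>m$; $X_{ij}X_{lm}-X_{lm}X_{ij}=\widehat{q}\,X_{im}X_{lj}$ for $i<l$, $j<m$. Quantum minors: for $I=\{i_1<\cdots<i_t\}$ and $J=\{j_1<\cdots<j_t\}$, $[I|J]=\sum_{\sigma\in S_t}(-q)^{\ell(\sigma)}X_{i_1,j_{\sigma(1)}}\cdots X_{i_t,j_{\sigma(t)}}$, where $\ell(\sigma)$ is the length (number of inversions) of $\sigma$; $[\varnothing|\varnothing]=1$. For such $I,J$, $I\le J$ means $i_l\le j_l$ for all $l$; $I<J$ means $I\le J$ and $I\ne J$. For $S,T\subseteq\{1,\dots,n\}$, $\ell(S;T)=|\{(s,t)\in S\times T\mid s>t\}|$. For $d\in\mathbb{N}$, $[d]_{-q}=(-q)^{d-1}+(-q)^{d-3}+\cdots+(-q)^{-(d-1)}$. For index sets $U\ge V$ of the same cardinality $m$, write $U=\{r_1<\cdots<r_m\}$, set $d_l=|[1,r_l]\cap V|-l+1$ (which is $\ge1$) and define $\xi_q(U;V)=[d_1]_{-q}\cdots[d_m]_{-q}$, with $\xi_q(\varnothing;\varnothing)=1$. For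 $X,Y\subseteq\{1,\dots,n\}$: $\{<X\Vert Y\}=\{S\subseteq X\cup Y\mid X\cap Y\subseteq S,\ |S|=|X|,\ S<X\}$ and $\{>X\Vert Y\}=\{T\subseteq X\cup Y\mid X\cap Y\subseteq T,\ |T|=|X|,\ T>X\}$. For $X\cap Y\subseteq S\subseteq X\cup Y$, $S^\natural=S^\natural_{X,Y}=(X\cap Y)\sqcup\bigl((X\cup Y)\setminus S\bigr)$. For $S\in\{<X\Vert Y\}$ and $T\in\{>X\Vert Y\}$ (with $\natural$ taken relative to $X,Y$), $\mathcal{L}(S,X,Y)=\ell\bigl((S\setminus S^\natural)\cup(Y\setminus X);X\setminus S\bigr)-\ell\bigl((S\setminus S^\natural)\cup(Y\setminus X);S\setminus X\bigr)$, $\mathcal{L}^\natural(T,X,Y)=\ell\bigl((T^\natural\setminus T)\cup(X\setminus Y);T\setminus X\bigr)-\ell\bigl((T^\natural\setminus T)\cup(X\setminus Y);X\setminus T\bigr)$. *)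

(* Defs.v *)
From HB Require Import structures.
From mathcomp Require Import all_boot all_order all_algebra perm.
From mathcomp Require Import boolp.
From mathcomp Require Import monalg.

Set Implicit Arguments.
Unset Strict Implicit.
Unset Printing Implicit Defensive.

Import GRing.Theory.

Local Open Scope ring_scope.
Local Open Scope quotient_scope.

(* Rows, columns and index sets are 0-based: {1, ..., n} is encoded by 'I_n.  *)

Lemma malg_scaleAr (R : comNzRingType) (K : monomType) (c : R)
  (f g : {malg R[K]}) : c *: (f * g) = f * (c *: g).
Proof.
have cf : c%:MP * f = f * c%:MP.
  rewrite !malgM_def fgmulUg fgmulgU.
  by apply: eq_bigr => w _; rewrite mulm1 mul1m mulrC.
rewrite -(mul_malgC c (f * g)) -(mul_malgC c g).
by rewrite [LHS]mulrA [RHS]mulrA cf.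
Qed.

Section QuantumMatrices.
Variables (k : fieldType) (n : nat) (q : k).

Definition qhat : k := q - q^-1.

(* The free associative k-algebra on the X_ij: {fmonom T} is the free monoid  *)
(* of words over T.                                                           *)
Definition free_mat : Type := {malg k[{fmonom ('I_n * 'I_n)%type}]}.
HB.instance Definition _ := GRing.Lalgebra.on free_mat.

Definition freeX (i j : 'I_n) : free_mat := << fmu (i, j) >>.

(* [oq_relator f] : the relation f = 0 is imposed on the generators.          *)
Inductive oq_relator : free_mat -> Prop :=
| OqCol (i l j : 'I_n) : (i < l)%N ->
    oq_relator (freeX i j * freeX l j - q *: (freeX l j * freeX i j))
| OqRow (i j m : 'I_n) : (j < m)%N ->
    oq_relator (freeX i j * freeX i m - q *: (freeX i m * freeX i j))
| OqComm (i j l m : 'I_n) : (i < l)%N -> (m < j)%N ->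
    oq_relator (freeX i j * freeX l m - freeX l m * freeX i j)
| OqCross (i j l m : 'I_n) : (i < l)%N -> (j < m)%N ->
    oq_relator (freeX i j * freeX l m - freeX l m * freeX i j
                - qhat *: (freeX i m * freeX l j)).

Inductive oq_in_ideal : free_mat -> Prop :=
| OqIdeal0 : oq_in_ideal 0
| OqIdealD a f b g : oq_relator f -> oq_in_ideal g ->
    oq_in_ideal (a * f * b + g).

Definition oq_ideal : pred free_mat := fun f => `[< oq_in_ideal f >].

Lemma oq_in_ideal_rel f : oq_relator f -> oq_in_ideal f.
Proof.
move=> rf; have := OqIdealD 1 1 rf OqIdeal0.
by rewrite mul1r mulr1 addr0.
Qed.

Lemma oq_in_idealD f g : oq_in_ideal f -> oq_in_ideal g -> oq_in_ideal (f + g).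
Proof.
move=> If Ig; elim: If => [|a h b f' rh _ IH]; first by rewrite add0r.
by rewrite -addrA; apply: OqIdealD.
Qed.

Lemma oq_in_idealM c d f : oq_in_ideal f -> oq_in_ideal (c * f * d).
Proof.
elim=> [|a h b g rh _ IH]; first by rewrite mulr0 mul0r; apply: OqIdeal0.
rewrite mulrDr mulrDl !mulrA -(mulrA (c * a * h)).
exact: OqIdealD.
Qed.

Lemma oq_in_idealN f : oq_in_ideal f -> oq_in_ideal (- f).
Proof. by move=> /(oq_in_idealM (- 1) 1); rewrite mulr1 mulN1r. Qed.

Lemma oq_ideal_zmod_closed : zmod_closed oq_ideal.
Proof.
split=> [|f g /asboolP If /asboolP Ig]; apply/asboolP; first exact: OqIdeal0.
by apply: oq_in_idealD => //; apply: oq_in_idealN.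
Qed.

HB.instance Definition _ :=
  GRing.isZmodClosed.Build free_mat oq_ideal oq_ideal_zmod_closed.

Lemma oq_idealMl c f : f \in oq_ideal -> c * f \in oq_ideal.
Proof.
move=> /asboolP If; apply/asboolP.
by rewrite -[c * f]mulr1; apply: oq_in_idealM.
Qed.

Lemma oq_idealMr c f : f \in oq_ideal -> f * c \in oq_ideal.
Proof.
move=> /asboolP If; apply/asboolP.
by rewrite -[f]mul1r; apply: oq_in_idealM.
Qed.

Definition cst_coeff (f : free_mat) : k := mcoeff (@mone _) f.

Lemma cst_coeffM f g : cst_coeff (f * g) = cst_coeff f * cst_coeff g.
Proof.
have [cM _] := @mcoeff1g_is_multiplicative {fmonom ('I_n * 'I_n)%type} k.
exact: cM.
Qed.

Lemma cst_coeffX i j : cst_coeff (freeX i j) = 0.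
Proof.
rewrite /cst_coeff /freeX mcoeffU.
case: eqP => // /(congr1 (fun w : fmonom _ => size w)).
by rewrite fmU fm1.
Qed.

Lemma cst_coeffB f g :
  cst_coeff f = 0 -> cst_coeff g = 0 -> cst_coeff (f - g) = 0.
Proof.
by move=> f0 g0; rewrite /cst_coeff mcoeffB -!/(cst_coeff _) f0 g0 subr0.
Qed.

Lemma cst_coeffZ c f : cst_coeff f = 0 -> cst_coeff (c *: f) = 0.
Proof. by move=> f0; rewrite /cst_coeff mcoeffZ -/(cst_coeff _) f0 mulr0. Qed.

Lemma cst_coeff_mulX f i j : cst_coeff (f * freeX i j) = 0.
Proof. by rewrite cst_coeffM cst_coeffX mulr0. Qed.

Lemma oq_relator_cst f : oq_relator f -> cst_coeff f = 0.
Proof.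
by case=> *; do !apply: cst_coeffB; do ?apply: cst_coeffZ;
  apply: cst_coeff_mulX.
Qed.

Lemma oq_ideal1 : 1 \notin oq_ideal.
Proof.
apply/negP => /asboolP I1.
suff coef0 f : oq_in_ideal f -> cst_coeff f = 0.
  have := coef0 _ I1; rewrite /cst_coeff mcoeff1 eqxx => /eqP.
  by rewrite oner_eq0.
elim=> [|a h b g rh _ IH]; first exact: mcoeff0.
rewrite /cst_coeff mcoeffD -!/(cst_coeff _) IH 2!cst_coeffM.
by rewrite (oq_relator_cst rh) mulr0 mul0r addr0.
Qed.

(* O_q(M_n(k)): the free algebra modulo that ideal, with the induced          *)
(* k-algebra structure.                                                       *)
Definition oqmat : Type := Quotient.quot (GRing.ZmodClosed.clone free_mat oq_ideal _).
HB.instance Definition _ := GRing.Zmodule.on oqmat.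
HB.instance Definition _ := EqQuotient.on oqmat.

Definition oq_pi (f : free_mat) : oqmat := \pi f.

Lemma oq_piP f g : oq_pi f = oq_pi g <-> f - g \in oq_ideal.
Proof.
by rewrite (Quotient.idealrBE (GRing.ZmodClosed.clone free_mat oq_ideal _)); split=> [/eqP|/eqP].
Qed.

Lemma oq_piK x : oq_pi (repr x) = x.
Proof. exact: reprK. Qed.

Lemma oq_repr_pi f : f - repr (oq_pi f) \in oq_ideal.
Proof. by apply/oq_piP; rewrite oq_piK. Qed.

Lemma oq_piD f g : oq_pi (f + g) = oq_pi f + oq_pi g.
Proof. exact: (Quotient.pi_add (GRing.ZmodClosed.clone free_mat oq_ideal _)). Qed.

Lemma oq_piN f : oq_pi (- f) = - oq_pi f.
Proof. exact: (Quotient.pi_opp (GRing.ZmodClosed.clone free_mat oq_ideal _)). Qed.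

Definition oq_one : oqmat := oq_pi 1.
(* Locked so that unification does not unfold products down to {malg _}.      *)
Fact oq_key : unit. Proof. by []. Qed.
Definition oq_mul : oqmat -> oqmat -> oqmat :=
  locked_with oq_key (fun x y => oq_pi (repr x * repr y)).
Definition oq_scale : k -> oqmat -> oqmat :=
  locked_with oq_key (fun c x => oq_pi (c *: repr x)).

Lemma oq_mulE x y : oq_mul x y = oq_pi (repr x * repr y).
Proof. by rewrite /oq_mul unlock. Qed.

Lemma oq_scaleE c x : oq_scale c x = oq_pi (c *: repr x).
Proof. by rewrite /oq_scale unlock. Qed.

Lemma oq_piM f g : oq_pi (f * g) = oq_mul (oq_pi f) (oq_pi g).
Proof.
rewrite oq_mulE; apply/oq_piP; set f' := repr _; set g' := repr _.
have -> : f * g - f' * g' = f * (g - g') + (f - f') * g'.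
  by rewrite mulrBr mulrBl addrA addrNK.
by apply: rpredD; [apply: oq_idealMl | apply: oq_idealMr]; apply: oq_repr_pi.
Qed.

Lemma oq_piZ c f : oq_pi (c *: f) = oq_scale c (oq_pi f).
Proof.
rewrite oq_scaleE; apply/oq_piP; rewrite -scalerBr -[_ - _]mul1r scalerAl.
by apply: oq_idealMl; apply: oq_repr_pi.
Qed.

Lemma oq_mulA : associative oq_mul.
Proof.
by move=> x y z; rewrite -[x]oq_piK -[y]oq_piK -[z]oq_piK -!oq_piM mulrA.
Qed.

Lemma oq_mul1 : left_id oq_one oq_mul.
Proof. by move=> x; rewrite -[x]oq_piK -oq_piM mul1r. Qed.

Lemma oq_mulr1 : right_id oq_one oq_mul.
Proof. by move=> x; rewrite -[x]oq_piK -oq_piM mulr1. Qed.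

Lemma oq_mulDl : left_distributive oq_mul +%R.
Proof.
move=> x y z; rewrite -[x]oq_piK -[y]oq_piK -[z]oq_piK.
by rewrite -oq_piD -!oq_piM -oq_piD mulrDl.
Qed.

Lemma oq_mulDr : right_distributive oq_mul +%R.
Proof.
move=> x y z; rewrite -[x]oq_piK -[y]oq_piK -[z]oq_piK.
by rewrite -oq_piD -!oq_piM -oq_piD mulrDr.
Qed.

Lemma oq_one_neq0 : oq_one != 0.
Proof.
apply/eqP; have -> : 0 = oq_pi 0 by apply/esym/(@addIr _ (oq_pi 0));
  rewrite -oq_piD !add0r.
by move=> /oq_piP; rewrite subr0 (negbTE oq_ideal1).
Qed.

HB.instance Definition _ := GRing.Zmodule_isNzRing.Build oqmat
  oq_mulA oq_mul1 oq_mulr1 oq_mulDl oq_mulDr oq_one_neq0.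

Lemma oq_scaleA a b x : oq_scale a (oq_scale b x) = oq_scale (a * b) x.
Proof. by rewrite -[x]oq_piK -!oq_piZ scalerA. Qed.

Lemma oq_scale1 : left_id 1 oq_scale.
Proof. by move=> x; rewrite -[x]oq_piK -oq_piZ scale1r. Qed.

Lemma oq_scaleDr : right_distributive oq_scale +%R.
Proof.
move=> c x y; rewrite -[x]oq_piK -[y]oq_piK.
by rewrite -oq_piD -!oq_piZ -oq_piD scalerDr.
Qed.

Lemma oq_scaleDl x : {morph oq_scale^~ x : a b / a + b}.
Proof. by move=> a b; rewrite -[x]oq_piK -!oq_piZ -oq_piD scalerDl. Qed.

HB.instance Definition _ := GRing.Zmodule_isLmodule.Build k oqmat
  oq_scaleA oq_scale1 oq_scaleDr oq_scaleDl.

Lemma oq_scaleAl (c : k) (x y : oqmat) : c *: (x * y) = (c *: x) * y.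
Proof.
rewrite -[x]oq_piK -[y]oq_piK.
change (oq_scale c (oq_mul (oq_pi (repr x)) (oq_pi (repr y))) =
        oq_mul (oq_scale c (oq_pi (repr x))) (oq_pi (repr y))).
by rewrite -oq_piM -!oq_piZ -oq_piM scalerAl.
Qed.

HB.instance Definition _ := GRing.Lmodule_isLalgebra.Build k oqmat oq_scaleAl.

Lemma oq_scaleAr (c : k) (x y : oqmat) : c *: (x * y) = x * (c *: y).
Proof.
rewrite -[x]oq_piK -[y]oq_piK.
change (oq_scale c (oq_mul (oq_pi (repr x)) (oq_pi (repr y))) =
        oq_mul (oq_pi (repr x)) (oq_scale c (oq_pi (repr y)))).
by rewrite -oq_piM -!oq_piZ -oq_piM malg_scaleAr.
Qed.

HB.instance Definition _ := GRing.Lalgebra_isAlgebra.Build k oqmat oq_scaleAr.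

Definition oqX (i j : 'I_n) : oqmat := oq_pi (freeX i j).

Lemma oq_pi_eq f g : oq_relator (f - g) -> oq_pi f = oq_pi g.
Proof. by move=> r; apply/oq_piP/asboolP/oq_in_ideal_rel. Qed.

Lemma oq_piXX (i j l m : 'I_n) :
  oq_pi (freeX i j * freeX l m) = oqX i j * oqX l m.
Proof. exact: oq_piM. Qed.

Lemma oq_piZXX c (i j l m : 'I_n) :
  oq_pi (c *: (freeX i j * freeX l m)) = c *: (oqX i j * oqX l m).
Proof. by rewrite oq_piZ oq_piXX. Qed.

Lemma oq_piBXX (i j l m i' j' l' m' : 'I_n) :
  oq_pi (freeX i j * freeX l m - freeX i' j' * freeX l' m') =
  oqX i j * oqX l m - oqX i' j' * oqX l' m'.
Proof.
apply: etrans (oq_piD _ _) _.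
by apply: congr2; [|apply: etrans (oq_piN _) (congr1 _ _)]; apply: oq_piXX.
Qed.

Lemma oqX_col (i l j : 'I_n) : (i < l)%N ->
  oqX i j * oqX l j = q *: (oqX l j * oqX i j).
Proof.
move=> il; apply: etrans (esym (oq_piXX i j l j)) _.
exact: etrans (oq_pi_eq (OqCol j il)) (oq_piZXX q l j i j).
Qed.

Lemma oqX_row (i j m : 'I_n) : (j < m)%N ->
  oqX i j * oqX i m = q *: (oqX i m * oqX i j).
Proof.
move=> jm; apply: etrans (esym (oq_piXX i j i m)) _.
exact: etrans (oq_pi_eq (OqRow i jm)) (oq_piZXX q i m i j).
Qed.

Lemma oqX_comm (i j l m : 'I_n) : (i < l)%N -> (m < j)%N ->
  oqX i j * oqX l m = oqX l m * oqX i j.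
Proof.
move=> il mj; apply: etrans (esym (oq_piXX i j l m)) _.
exact: etrans (oq_pi_eq (OqComm il mj)) (oq_piXX l m i j).
Qed.

Lemma oqX_cross (i j l m : 'I_n) : (i < l)%N -> (j < m)%N ->
  oqX i j * oqX l m - oqX l m * oqX i j = qhat *: (oqX i m * oqX l j).
Proof.
move=> il jm; apply: etrans (esym (oq_piBXX i j l m l m i j)) _.
exact: etrans (oq_pi_eq (OqCross il jm)) (oq_piZXX qhat i m l j).
Qed.

End QuantumMatrices.

Definition perm_length (t : nat) (s : 'S_t) : nat :=
  #|[set p : 'I_t * 'I_t | (p.1 < p.2)%N && (s p.2 < s p.1)%N]|.

(* The quantum minor [I|J], meaningful when #|I| = #|J|.  [enum I] lists I in *)
(* increasing order, so [enum_val l] is the l-th element of I and             *)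
(* [nth _ (enum J) (s l)] the s(l)-th element of J; the default value of nth  *)
(* is never reached when #|I| = #|J|.                                         *)
Definition qminor (k : fieldType) (n : nat) (q : k) (I J : {set 'I_n}) :
    oqmat n q :=
  \sum_(s : 'S_#|I|) (- q) ^+ perm_length s *:
    \prod_(l < #|I|) oqX q (enum_val l) (nth (enum_val l) (enum J) (s l)).

Section IndexSets.
Variable n : nat.
Implicit Types I J S T U V X Y : {set 'I_n}.

(* all2 also requires equal cardinalities. *)
Definition ile I J : bool :=
  all2 (fun i j : 'I_n => (i <= j)%N) (enum I) (enum J).

Definition ilt I J : bool := ile I J && (I != J).

Definition ell S T : nat :=
  #|[set p : 'I_n * 'I_n | [&& p.1 \in S, p.2 \in T & (p.2 < p.1)%N]]|.

(* {<X||Y} and {>X||Y} *)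
Definition lt_sets X Y : {set {set 'I_n}} :=
  [set S : {set 'I_n} | [&& S \subset X :|: Y, X :&: Y \subset S,
                          #|S| == #|X| & ilt S X]].

Definition gt_sets X Y : {set {set 'I_n}} :=
  [set T : {set 'I_n} | [&& T \subset X :|: Y, X :&: Y \subset T,
                          #|T| == #|X| & ilt X T]].

(* S^natural relative to X, Y *)
Definition natural X Y S : {set 'I_n} :=
  (X :&: Y) :|: ((X :|: Y) :\: S).

(* The exponents L(S,X,Y) and L^natural(T,X,Y); the prime is ^natural.        *)
Definition Lexp S X Y : int :=
  let S' := natural X Y S in
  (ell ((S :\: S') :|: (Y :\: X)) (X :\: S))%:Z
  - (ell ((S :\: S') :|: (Y :\: X)) (S :\: X))%:Z.

Definition Lexp_nat T X Y : int :=
  let T' := natural X Y T in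
  (ell ((T' :\: T) :|: (X :\: Y)) (T :\: X))%:Z
  - (ell ((T' :\: T) :|: (X :\: Y)) (X :\: T))%:Z.

Variables (k : fieldType) (q : k).

(* [d]_{-q} *)
Definition qint (d : nat) : k :=
  \sum_(i < d) (- q) ^ (d%:Z - 1 - (2 * i)%:Z).

(* With l counted from 0, d_l = |[1, r_l] n V| - l; this subtraction does not *)
(* truncate when U >= V.                                                      *)
Definition xi U V : k :=
  \prod_(l < #|U|)
    qint (#|[set v in V | (v <= (enum_val l : 'I_n))%N]| - l)%N.

Definition mu_coef J N S : k :=
  (- qhat q) ^+ #|S :\: J| * (- q) ^ (- Lexp_nat S J N)
  * xi (S :\: J) (J :\: S).

Definition lambda_coef I M T : k :=
  (- qhat q) ^+ #|I :\: T| * (- q) ^ (- Lexp T I M)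
  * xi (I :\: T) (T :\: I).

End IndexSets.

(* Main.v *)
(* The coquasitriangular structure of O_q(M_n), in coordinates. The exterior
   algebra of k^n carries L-operators L_ij ([lop], an upper triangular family of
   operators on the span of the subsets of 'I_n) which satisfy the column
   relations of quantum matrices and intertwine the matrix T = ([M|N])_(M, N)
   of all quantum minors:
       (sum_l L_il X_lj) T = T (sum_l X_il L_lj).
   Taking the (I, J) minor of both sides and expanding it by Cauchy-Binet gives
   a commutation relation between [I|J] and [M|N] whose coefficients are the
   matrix entries of the minors of L. Expanding those minors along their
   smallest column shows that each nonzero entry is, up to sign, a power of q
   times a power of q - q^-1 times a product of [d]_{-q}: these are the
   coefficients of the theorem. *)
Require Import Defs.
From HB Require Import structures.
From mathcomp Require Import all_boot all_order all_algebra perm.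
From mathcomp Require Import zify ring.

Set Implicit Arguments.
Unset Strict Implicit.
Unset Printing Implicit Defensive.

Import GRing.Theory.

Local Open Scope ring_scope.

(** * Subsets of ordinals *)

Section OrdinalSets.
Variable n : nat.
Implicit Types (K I : {set 'I_n}) (i j k : 'I_n).

(** The intertwining relation is checked one column at a time: column [N] of T is obtained from a
    unit vector by one coaction operator [wop] per element of [N], so it suffices to commute sum_l
    L_il X_lj past a single such operator. Minors are defined recursively over an arbitrary ring
    with a central [c], because they are taken in three rings: A, matrices over k and matrices over
    A. Cauchy-Binet needs only the relations inside pairs of columns, which the L-operators share
    with the generators. A matrix entry of a minor of L is a large sum with cancellations. It is not
    simplified directly: the closed form is written down and shown to obey the same recursion. No
    quantum integer is ever inverted, so q may be a root of unity. The powers of q in the theorem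
    cancel the leading entries, which are q^-|I n M| and q^-|J n N|. The order conditions on the
    index sets come from the vanishing of [xi]. *)

Definition below I i := #|[set t in I | (t < i)%N]|.

Let lto := relpre (@nat_of_ord n) ltn.

Let lto_tr : transitive lto. Proof. by move=> ? ? ? /=; apply: ltn_trans. Qed.

Lemma sorted_enum_ord K : sorted lto (enum K).
Proof.
rewrite /enum_mem -enumT -(@sorted_map _ _ _ ltn).
apply: (subseq_sorted ltn_trans _ (iota_ltn_sorted 0 n)).
by rewrite -val_enum_ord; apply/map_subseq/filter_subseq.
Qed.

Lemma enum_setU1_min k0 K : (forall t, t \in K -> (k0 < t)%N) ->
  enum (k0 |: K) = k0 :: enum K.
Proof.
move=> k0K.
apply: (irr_sorted_eq lto_tr); rewrite ?sorted_enum_ord //.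
- by move=> i; rewrite /lto /= ltnn.
- rewrite /= (path_sortedE lto_tr) sorted_enum_ord andbT.
  by apply/allP => t; rewrite mem_enum; apply: k0K.
- by move=> t; rewrite mem_enum !inE mem_enum.
Qed.

(** Induction adapted to expansion along the smallest column: by [enum_setU1_min], adding a new
    minimum is a cons on [enum]. *)
Lemma set_min_ind (P : {set 'I_n} -> Prop) : P set0 ->
  (forall k0 K, (forall t, t \in K -> (k0 < t)%N) -> P K -> P (k0 |: K)) ->
  forall K, P K.
Proof.
move=> P0 PU K; have [m] := ubnP #|K|; elim: m K => // m IH K.
have [->//|[i0 i0K]] := set_0Vmem K; rewrite ltnS => leK.
have [k0 k0K k0min] : exists2 k0, k0 \in K & forall t, t \in K -> (k0 <= t)%N.
  by case: (arg_minnP (fun i : 'I_n => i : nat) i0K) => k0; exists k0.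
rewrite -(setD1K k0K); apply: PU.
  by move=> t; rewrite !inE ltn_neqAle eq_sym => /andP[-> /k0min].
by apply: IH; rewrite (cardsD1 k0) k0K in leK.
Qed.

Lemma below_setD1 I i j : i \in I -> below I j = ((i < j) + below (I :\ i) j)%N.
Proof.
move=> iI; rewrite /below (cardsD1 i) !inE iI /=; congr (_ + _)%N.
by apply: eq_card => t; rewrite !inE andbA.
Qed.

Lemma below_setU1 I i j : i \notin I -> below (i |: I) j = ((i < j) + below I j)%N.
Proof. by move=> iI; rewrite (@below_setD1 (i |: I) i) ?setU11 // setU1K. Qed.

End OrdinalSets.

(** * Minors in a ring with a central parameter *)

Section Wedge.
Variables (n : nat) (R : pzRingType) (c : R) (x : 'I_n -> 'I_n -> R).
Implicit Types (I K : {set 'I_n}) (i j k l m : 'I_n) (f g : {set 'I_n} -> R).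

(* Left multiplication by the coaction of the j-th generator of the exterior
   algebra, a form being given by its coordinates on the sets of rows; the
   central element [c] plays the role of -q. *)
Definition wop j f I : R := \sum_(i in I) c ^+ below I i * x i j * f (I :\ i).

Fixpoint wminor_seq (js : seq 'I_n) : {set 'I_n} -> R :=
  if js is j :: js' then wop j (wminor_seq js') else fun I => (I == set0)%:R.

(** Coordinate at [I] of the product of the coactions of the generators in [K]. It is 0 when [I] and
    [K] differ in size, so sums over intermediate sets need no cardinality condition. *)
Definition wminor I K := wminor_seq (enum K) I.

Lemma eq_wop j f g I : f =1 g -> wop j f I = wop j g I.
Proof. by move=> fg; apply: eq_bigr => i _; rewrite fg. Qed.

Lemma wopMr j f a I : wop j (fun I => f I * a) I = wop j f I * a.
Proof. by rewrite mulr_suml; apply: eq_bigr => i _; rewrite mulrA. Qed.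

Lemma wop_sum j (T : finType) (P : pred T) (F : T -> {set 'I_n} -> R) I :
  wop j (fun I => \sum_(t | P t) F t I) I = \sum_(t | P t) wop j (F t) I.
Proof.
by rewrite exchange_big; apply: eq_bigr => i _; rewrite mulr_sumr.
Qed.

Lemma wopD j f g I : wop j (fun I => f I + g I) I = wop j f I + wop j g I.
Proof. by rewrite -big_split; apply: eq_bigr => i _; rewrite mulrDr. Qed.

Lemma wminor0 I : wminor I set0 = (I == set0)%:R.
Proof. by rewrite /wminor enum_set0. Qed.

Lemma wminorU1 k0 K I : (forall t, t \in K -> (k0 < t)%N) ->
  wminor I (k0 |: K) = wop k0 (wminor^~ K) I.
Proof. by move=> k0K; rewrite /wminor enum_setU1_min. Qed.

Hypothesis cC : forall y, c * y = y * c.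

Lemma commXc r y : c ^+ r * y = y * c ^+ r.
Proof. by elim: r => [|r IH]; rewrite ?expr0 ?mul1r ?mulr1 // exprS -mulrA IH mulrA cC
  mulrA. Qed.

Lemma wopMl j f r I : wop j (fun I => c ^+ r * f I) I = c ^+ r * wop j f I.
Proof.
rewrite mulr_sumr; apply: eq_bigr => i _.
by rewrite !mulrA -commXc !mulrA.
Qed.

(* Both orders of deleting [i < l] leave [I \ {i, l}]; they differ by a factor [c]. *)
Lemma wop2E j m f I :
  wop j (wop m f) I = \sum_(i in I) \sum_(l in I | (i < l)%N)
     c ^+ (below I i + below (I :\ i) l) *
       ((x i j * x l m + c * (x l j * x i m)) * f (I :\ i :\ l)).
Proof.
pose g i l := c ^+ (below I i + below (I :\ i) l) * (x i j * x l m * f (I :\ i :\ l)).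
have -> : wop j (wop m f) I = \sum_(i in I) \sum_(l in I | l != i) g i l.
  apply: eq_bigr => i iI; rewrite mulr_sumr; apply: eq_big => [l|l _].
    by rewrite !inE andbC.
  by rewrite /g exprD !mulrA -[_ * x i j * _]mulrA -commXc !mulrA.
transitivity (\sum_(i in I) (\sum_(l in I | (i < l)%N) g i l + \sum_(l in I | (l <
  i)%N) g i l)).
  apply: eq_bigr => i iI; rewrite (bigID (fun l : 'I_n => (i < l)%N)) /=.
  congr (_ + _); apply: eq_bigl => l; rewrite -andbA; congr (_ && _);
    rewrite -val_eqE /=; lia.
have -> : \sum_(i in I) (\sum_(l in I | (i < l)%N) g i l + \sum_(l in I | (l < i)%N) g
  i l)
    = \sum_(i in I) (\sum_(l in I | (i < l)%N) g i l + \sum_(l in I | (i < l)%N) g l i).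
  rewrite !big_split; congr (_ + _).
  rewrite (exchange_big_dep (fun l => l \in I)) /=; last by move=> ? ? _ /andP[].
  by apply: eq_bigr => l lI; apply: eq_bigl => i; rewrite lI.
apply: eq_bigr => i iI.
rewrite -big_split; apply: eq_bigr => l /andP[lI il].
rewrite /g mulrDl mulrDr; congr (_ + _).
have -> : I :\ l :\ i = I :\ i :\ l by rewrite !setDDl setUC.
have -> : (below I l + below (I :\ l) i = (below I i + below (I :\ i) l).+1)%N.
  by rewrite (below_setD1 l iI) (below_setD1 i lI) il ltnNge (ltnW il) /= add0n add1n
    addSn addnC.
by rewrite exprSr -!mulrA.
Qed.

(** Exactly what makes the operators [wop] satisfy the relations of a quantum exterior algebra
    ([wop_sq], [wop_swap]). For [c] = -q, the second line combines the commuting and the crossing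
    relation of quantum matrices. *)
Definition column_relations : Prop :=
  (forall i l j, (i < l)%N -> x i j * x l j = - (c * (x l j * x i j))) /\
  (forall i l j m, (i < l)%N -> (j < m)%N ->
    x i m * x l j + c * (x l m * x i j) =
    c * (x i j * x l m + c * (x l j * x i m))).

Hypothesis colx : column_relations.

Lemma wop_sq j f I : wop j (wop j f) I = 0.
Proof.
rewrite wop2E; apply: big1 => i _; apply: big1 => l /andP[_ il].
by rewrite (proj1 colx) // addNr mul0r mulr0.
Qed.

Lemma wop_swap j m f I : (j < m)%N ->
  wop m (wop j f) I = c * wop j (wop m f) I.
Proof.
move=> jm; rewrite !wop2E mulr_sumr; apply: eq_bigr => i _.
rewrite mulr_sumr; apply: eq_bigr => l /andP[_ il].
by rewrite (proj2 colx) // [RHS]mulrA [c * c ^+ _]cC -[RHS]mulrA (mulrA c (_ + _)).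
Qed.

(** The new generator is sorted into the increasing product: each smaller column it passes costs a
    factor [c], and a repeated column gives 0. *)
Lemma wop_wminor l K I :
  wop l (wminor^~ K) I =
  if l \in K then 0 else c ^+ below K l * wminor I (l |: K).
Proof.
elim/set_min_ind: K I => [|k0 K k0K IH] I.
  rewrite inE; have -> : below set0 l = 0%N.
    by apply: eq_card0 => t; rewrite !inE.
  by rewrite mul1r wminorU1 // => t; rewrite inE.
have k0nK : k0 \notin K by apply/negP => /k0K; rewrite ltnn.
rewrite (eq_wop _ _ (fun I => wminorU1 I k0K)) !inE.
have [->|lk0 /=] := eqVneq l k0; first exact: wop_sq.
have [ltlk|gtlk|/val_inj eqlk] := ltngtP l k0; last by rewrite eqlk eqxx in lk0.
  have lK : l \notin K by apply/negP => /k0K /(ltn_trans ltlk); rewrite ltnn.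
  have lmin t : t \in k0 |: K -> (l < t)%N.
    by rewrite !inE => /orP[/eqP->//|/k0K]; apply: ltn_trans.
  have -> : below (k0 |: K) l = 0%N.
    apply: eq_card0 => t; rewrite inE; apply/negP => /andP[/lmin lt].
    by rewrite ltnNge (ltnW lt).
  by rewrite (negbTE lK) mul1r (wminorU1 _ lmin); apply: eq_wop => J; rewrite wminorU1.
rewrite wop_swap // (eq_wop _ _ IH).
have [lK|lK] := boolP (l \in K).
  by rewrite /wop big1 ?mulr0 // => i _; rewrite mulr0.
rewrite wopMl mulrA -exprS below_setU1 // gtlk; congr (_ * _).
rewrite setUCA wminorU1 // => t; rewrite !inE => /orP[/eqP->//|/k0K //].
Qed.

End Wedge.

(** * Intertwining, Cauchy-Binet and transposition of minors *)

Section WedgeTheory.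
Variables (n : nat) (R : pzRingType) (c : R).
Hypothesis cC : forall y, c * y = y * c.
Implicit Types (I J K : {set 'I_n}) (i j k l m : 'I_n) (x L X : 'I_n -> 'I_n -> R).

(** [t] moves through each monomial factor by factor, so no relations among the entries of [Y] or
    [Y'] are required. *)
Lemma wminor_intertwine Y Y' (t : R) J I :
  (forall i j, Y i j * t = t * Y' i j) ->
  wminor c Y I J * t = t * wminor c Y' I J.
Proof.
move=> Yt; rewrite /wminor; elim: (enum J) I => [|j js IH] I /=.
  by rewrite mulr_natl mulr_natr.
rewrite mulr_suml mulr_sumr; apply: eq_bigr => i _.
by rewrite -mulrA IH mulrA -[_ * _ * t]mulrA Yt !mulrA (commXc cC _ t).
Qed.

Lemma commute_wminor X (t : R) J I :
  (forall i j, X i j * t = t * X i j) ->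
  wminor c X I J * t = t * wminor c X I J.
Proof. exact: wminor_intertwine. Qed.

(** Expanding the smallest column of the product lets the operator [wop] of L act on a minor of L,
    where [wop_wminor] evaluates it; what remains is the expansion of a minor of X. Hence only L has
    to satisfy the column relations. *)
Lemma wminorM L X I J : column_relations c L ->
  (forall i j l m, X l m * L i j = L i j * X l m) ->
  wminor c (fun i j => \sum_l L i l * X l j) I J =
  \sum_K wminor c L I K * wminor c X K J.
Proof.
move=> colL LX; elim/set_min_ind: J I => [|j0 J j0J IH] I.
  rewrite (bigD1 set0) //= big1 => [|K K0]; rewrite !wminor0 ?eqxx ?mulr1 ?addr0 //.
  by rewrite (negbTE K0) mulr0.
rewrite wminorU1 // (eq_wop _ _ _ _ IH).
transitivity (\sum_l \sum_K wop c L l (fun I => wminor c L I K) I * (X l j0 * wminor c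
  X K J)).
  rewrite /wop; under eq_bigr => i _ do rewrite -mulrA mulr_suml mulr_sumr.
  rewrite exchange_big /=; apply: eq_bigr => l _.
  under eq_bigr => i _ do rewrite !mulr_sumr.
  rewrite exchange_big /=; apply: eq_bigr => K _.
  rewrite mulr_suml; apply: eq_bigr => i _.
  rewrite !mulrA; congr (_ * _); rewrite -!mulrA; congr (_ * (_ * _)).
  by rewrite commute_wminor.
under eq_bigr => l _ do under eq_bigr => K _ do rewrite (wop_wminor cC colL).
transitivity (\sum_l \sum_(K : {set 'I_n} | l \in K)
    c ^+ below K l * wminor c L I K * (X l j0 * wminor c X (K :\ l) J)).
  apply: eq_bigr => l _; rewrite (bigID (fun K : {set 'I_n} => l \in K)) /=.
  rewrite big1 ?add0r => [|K ->]; last by rewrite mul0r.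
  (* The sets avoiding [l] are reindexed by the sets containing it, through [K] -> [l |: K]. *)
  rewrite (reindex_onto (fun K => K :\ l) (fun K => l |: K)) /=; last first.
    by move=> K lK; rewrite setU1K.
  apply: eq_big => [K|K /andP[+ /eqP KE]]; rewrite !inE eqxx /=.
    have [lK|lK] := boolP (l \in K); first by rewrite setD1K ?eqxx.
    by apply/negP => /eqP KE; rewrite -KE setU11 in lK.
  move=> _; have lK : l \in K by rewrite -KE setU11.
  by rewrite KE (below_setD1 l lK) ltnn.
rewrite (exchange_big_dep predT) //=; apply: eq_bigr => K _.
rewrite wminorU1 // mulr_sumr; apply: eq_bigr => l lK.
by rewrite !mulrA; congr (_ * _ * _); apply: commXc.
Qed.

(* Expanding both sides along their first row and first column gives the same
   double sum, up to exchanging [x i0 j] and [x i j0]. *)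
Lemma wminor_tr x I J :
  (forall i j l m, (i < l)%N -> (m < j)%N -> x i j * x l m = x l m * x i j) ->
  #|I| = #|J| -> wminor c x I J = wminor c (fun i j => x j i) J I.
Proof.
move=> xC; have [t] := ubnP #|I|; elim: t I J => // t IH I J.
elim/set_min_ind: I => [_|i0 I i0I _].
  rewrite cards0 => /esym/eqP; rewrite cards_eq0 => /eqP->.
  by rewrite !wminor0.
have i0nI : i0 \notin I by apply/negP => /i0I; rewrite ltnn.
elim/set_min_ind: J => [_|j0 J j0J _]; first by rewrite cards0 cardsU1 i0nI.
have j0nJ : j0 \notin J by apply/negP => /j0J; rewrite ltnn.
rewrite !cardsU1 i0nI j0nJ !add1n ltnS => ltIt [eqIJ].
have below0 k0 K : (forall t, t \in K -> (k0 < t)%N) -> below K k0 = 0%N.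
  move=> k0K; apply: eq_card0 => u; rewrite inE; apply/negP => /andP[/k0K lt].
  by rewrite ltnNge (ltnW lt).
rewrite !wminorU1 // /wop.
rewrite (big_setU1 _ i0nI) (big_setU1 _ j0nJ) /=.
rewrite !below_setU1 // ltnn (below0 i0) // (below0 j0) // !setU1K // IH //.
congr (_ + _); first by rewrite ltnn.
transitivity (\sum_(i in I) \sum_(j in J) c ^+ (below I i + below J j).+1 *
   (x i j0 * x i0 j * wminor c x (I :\ i) (J :\ j))).
  apply: eq_bigr => i iI.
  have i0ni : i0 \notin [set i] by rewrite inE; apply: contraNneq i0nI => ->.
  have -> : (i0 |: I) :\ i = i0 |: (I :\ i).
    apply/setP => u; rewrite !inE; have [->|//] := eqVneq u i0.
    by rewrite inE in i0ni; rewrite i0ni.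
  have i0Ii u : u \in I :\ i -> (i0 < u)%N by rewrite inE => /andP[_ /i0I].
  have cardI : #|I| = #|I :\ i|.+1 by rewrite (cardsD1 i) iI.
  rewrite IH; last first.
  - by rewrite cardsU1 !inE (negbTE i0nI) andbF add1n -cardI.
  - by rewrite cardsU1 !inE (negbTE i0nI) andbF add1n -cardI.
  rewrite wminorU1 // mulr_sumr; apply: eq_bigr => j jJ.
  rewrite below_setU1 // (i0I _ iI) add1n -addSn exprD !mulrA -[_ * x i j0 * _]mulrA
    -(commXc cC) !mulrA.
  congr (_ * _); rewrite IH //; first by rewrite -ltnS -cardI ltnW.
  by apply/eqP; rewrite -eqSS -cardI eqIJ (cardsD1 j J) jJ.
rewrite exchange_big; apply: eq_bigr => j jJ.
have jj0 : j0 != j by apply: contraNneq j0nJ => ->.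
have -> : (j0 |: J) :\ j = j0 |: (J :\ j).
  by apply/setP => u; rewrite !inE; have [->|//] := eqVneq u j0; rewrite jj0.
have cardJ : #|J| = #|J :\ j|.+1 by rewrite (cardsD1 j) jJ.
rewrite -IH; last first.
- by rewrite cardsU1 !inE (negbTE j0nJ) andbF add1n -cardJ.
- by [].
rewrite wminorU1; last by move=> u; rewrite inE => /andP[_ /j0J].
rewrite mulr_sumr; apply: eq_bigr => i iI.
rewrite below_setU1 // (j0J _ jJ) add1n addnC -addSn exprD.
rewrite -(xC i0 j) ?i0I ?j0J //.
by rewrite -!mulrA; congr (_ * _); rewrite !mulrA; congr (_ * _ * _); apply: commXc.
Qed.

End WedgeTheory.

(** * Quantum minors as sums over permutations *)

Lemma sorted_nth_enum n (K : {set 'I_n}) i0 (a b : nat) :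
  (a < #|K|)%N -> (b < #|K|)%N ->
  (nth i0 (enum K) a < nth i0 (enum K) b)%N = (a < b)%N.
Proof.
have mono a' b' : (a' < #|K|)%N -> (b' < #|K|)%N -> (a' < b')%N ->
    (nth i0 (enum K) a' < nth i0 (enum K) b')%N.
  move=> aK bK ab; have tr : transitive (relpre (@nat_of_ord n) ltn).
    by move=> ? ? ? /=; apply: ltn_trans.
  by apply: (sorted_ltn_nth tr i0 (sorted_enum_ord K)); rewrite ?inE -?cardE.
move=> aK bK; have [/mono->//|ba|->] := ltngtP a b; last by rewrite ltnn.
by apply/negbTE; rewrite -leqNgt ltnW // mono.
Qed.

Lemma below_nth n (K : {set 'I_n}) i0 (a : nat) : (a < #|K|)%N ->
  below K (nth i0 (enum K) a) = a.
Proof.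
move=> aK; have aE : (a < size (enum K))%N by rewrite -cardE.
transitivity #|take a (enum K)|; last first.
  by rewrite (card_uniqP (take_uniq _ (enum_uniq _))) size_takel // ltnW.
apply: eq_card => t; rewrite !inE; have [tK|tK] := boolP (t \in K).
  rewrite in_take ?mem_enum // -[t in LHS](nth_index i0 (s := enum K)) ?mem_enum //.
  by rewrite sorted_nth_enum // cardE index_mem mem_enum.
by apply/esym/negbTE; apply: contra tK => /mem_take; rewrite mem_enum.
Qed.

Lemma nth_enum_setD1 n (K : {set 'I_n}) i0 (a b : nat) : (a < #|K|)%N ->
  nth i0 (enum (K :\ nth i0 (enum K) a)) b = nth i0 (enum K) (bump a b).
Proof.
move=> aK; set e := nth i0 (enum K) a.
have -> : enum (K :\ e) = rem e (enum K).
  rewrite rem_filter ?enum_uniq // {1}/enum_mem -filter_predI.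
  by apply: eq_filter => t; rewrite !inE.
have -> : rem e (enum K) = take a (enum K) ++ drop a.+1 (enum K).
  by rewrite remE /e index_uniq ?enum_uniq -?cardE.
rewrite nth_cat size_takel /bump; last by rewrite -cardE ltnW.
have [ba|ab] := ltnP b a; first by rewrite nth_take // add0n.
by rewrite nth_drop addSn subnKC.
Qed.

Lemma perm_lengthE t (s : 'S_t) :
  perm_length s = (\sum_(a < t) \sum_(b < t) ((a < b) && (s b < s a)))%N.
Proof.
rewrite /perm_length -sum1dep_card big_mkcond pair_bigA /=.
by apply: eq_bigr => p _; case: ifP.
Qed.

(** Position 0 is inverted with exactly the [j] positions whose images are smaller than [j];
    skipping the value [j] keeps the order of the others. *)
Lemma perm_length_lift t (j : 'I_t.+1) (s : 'S_t) :
  perm_length (lift_perm ord0 j s) = (j + perm_length s)%N.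
Proof.
rewrite !perm_lengthE big_ord_recl; congr (_ + _)%N.
  rewrite big_ord_recl ltnn add0n lift_perm_id.
  under eq_bigr => b _ do rewrite lift_perm_lift /=.
  rewrite (reindex_inj (@perm_inj _ s^-1)) /=.
  under eq_bigr => b _ do rewrite permKV.
  rewrite (eq_bigr (fun b : 'I_t => ((b < j) : nat))); last first.
    by move=> b _; rewrite /bump; case: (leqP j b) => jb /=; lia.
  rewrite -big_mkcond /= sum1_card -[RHS](card_ord j) -!sum1_card.
  by rewrite (big_ord_widen t (fun=> 1%N)) // -ltnS.
apply: eq_bigr => a _; rewrite big_ord_recl /= add0n.
apply: eq_bigr => b _; rewrite !lift_perm_lift.
have -> : (bump 0 a < bump 0 b)%N = (a < b)%N by [].
congr (nat_of_bool (_ && _)).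
by rewrite /= /bump; case: (leqP j (s a)); case: (leqP j (s b)); lia.
Qed.


Lemma lift_perm_bij t :
  bijective (fun p : 'I_t.+1 * 'S_t => lift_perm ord0 p.1 p.2).
Proof.
apply: inj_card_bij; last first.
  by rewrite card_prod !card_Sn card_ord factS.
move=> [j s] [j' s'] /= eqjs.
have eqj : j = j' by have := congr1 (fun u : 'S_t.+1 => u ord0) eqjs;
  rewrite !lift_perm_id.
subst j'; congr (_, _); apply/permP => a; apply: (@lift_inj _ j).
by rewrite -!(@lift_perm_lift _ ord0) eqjs.
Qed.

(** Grouping permutations by the image of 0 gives the Laplace expansion along the first row. The
    rows form an arbitrary family [a], so that the induction can drop its first member. *)
Lemma perm_expansion (k : comNzRingType) (R : algType k) n (c : k)
    (x : 'I_n -> 'I_n -> R) t (a : 'I_t -> 'I_n) (J : {set 'I_n}) :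
  #|J| = t ->
  \sum_(s : 'S_t) c ^+ perm_length s *:
     \prod_(l < t) x (a l) (nth (a l) (enum J) (s l)) =
  wminor_seq c%:A (fun j i => x i j) [seq a l | l <- enum 'I_t] J.
Proof.
elim: t a J => [|t IH] a J cardJ.
  have -> : enum 'I_0 = [::] by apply: size0nil; rewrite size_enum_ord.
  rewrite (cards0_eq cardJ) /= eqxx.
  rewrite (big_pred1 (1%g : 'S_0)).
    by rewrite big_ord0 perm_lengthE big_ord0 expr0 scale1r.
  by move=> s; apply/esym/eqP/permP; case.
rewrite (reindex _ (onW_bij _ (lift_perm_bij t))) /=.
rewrite -(pair_bigA _ (fun j s => c ^+ perm_length (lift_perm ord0 j s) *:
  \prod_(l < t.+1) x (a l) (nth (a l) (enum J) (lift_perm ord0 j s l)))) /=.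
rewrite enum_ordSl /= /wop -[RHS]big_enum [RHS](big_nth (a ord0)) -cardE cardJ big_mkord.
apply: eq_bigr => j _.
have jJ : (j < #|J|)%N by rewrite cardJ.
rewrite below_nth // -map_comp -IH //=; last first.
  have : nth (a ord0) (enum J) j \in J by rewrite -mem_enum mem_nth // -cardE.
  by move=> eJ; have := cardsD1 (nth (a ord0) (enum J) j) J;
    rewrite eJ cardJ add1n => -[<-].
rewrite mulr_sumr; apply: eq_bigr => s _.
rewrite perm_length_lift big_ord_recl lift_perm_id /=.
rewrite -(rmorphXn (GRing.in_alg R)) /= -mulrA mulr_algl exprD -scalerA.
congr (_ *: _); rewrite -scalerAr; congr (_ *: (_ * _)).
apply: eq_bigr => l _; rewrite lift_perm_lift.
by rewrite (set_nth_default (a (lift ord0 l)) (a ord0)) -?cardE // nth_enum_setD1.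
Qed.

(** The permutation sum multiplies row by row and [wminor] column by column, hence the passage
    through the transpose. *)
Lemma qminorE (k : fieldType) (n : nat) (q : k) (I J : {set 'I_n}) :
  #|I| = #|J| -> qminor q I J = wminor (- q)%:A (@oqX k n q) I J.
Proof.
move=> cardIJ; rewrite wminor_tr; first last.
- exact: cardIJ.
- by move=> i j l m; apply: oqX_comm.
- by move=> y; rewrite mulr_algl mulr_algr.
rewrite /qminor (perm_expansion (- q) (@oqX k n q) (@enum_val _ (mem I))) //.
rewrite /wminor; congr wminor_seq.
have [I0|[i0 _]] := set_0Vmem I.
  by rewrite {}I0 enum_set0; apply: size0nil; rewrite size_map size_enum_ord cards0.
apply: (@eq_from_nth _ i0) => [|l]; rewrite size_map size_enum_ord ; first exact: cardE.
move=> lI; rewrite (nth_map (Ordinal lI)) ?size_enum_ord //.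
by rewrite (enum_val_nth i0) nth_enum_ord.
Qed.

(** * The L-operators on the exterior algebra *)

Section SetMatrices.
Variables (T : finType) (R : pzRingType).
Implicit Types f g : T -> T -> R.

Definition smx f : 'M[R]_#|T| := \matrix_(a, b) f (enum_val a) (enum_val b).

Lemma smxE f s t : smx f (enum_rank s) (enum_rank t) = f s t.
Proof. by rewrite mxE !enum_rankK. Qed.

Lemma smxP (A B : 'M[R]_#|T|) :
  (forall s t, A (enum_rank s) (enum_rank t) = B (enum_rank s) (enum_rank t)) ->
  A = B.
Proof. by move=> AB; apply/matrixP => a b; rewrite -(enum_valK a) -(enum_valK b). Qed.

Lemma smx_mulE (A B : 'M[R]_#|T|) s t :
  (A * B) (enum_rank s) (enum_rank t) =
  \sum_u A (enum_rank s) (enum_rank u) * B (enum_rank u) (enum_rank t).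
Proof. by rewrite mxE (reindex _ (onW_bij _ (@enum_rank_bij T))). Qed.

End SetMatrices.

Section LOperators.
Variables (k : fieldType) (n : nat) (q : k).
Implicit Types (M P : {set 'I_n}) (i j l m : 'I_n).

Definition between M i j := #|[set t in M | (i < t < j)%N]|.

Definition shift i j M := if i == j then M else i |: (M :\ j).

(** The only possibly nonzero entry of row [M] of L_ij, found in column [shift i j M]. On singletons
    these are the entries of an R-matrix of type A; in general, replacing [j] by [i] costs a factor
    -q for each element of [M] jumped over. *)
Definition lcoef i j M : k :=
  if i == j then q^-1 ^+ (i \in M)
  else if [&& (i < j)%N, i \notin M & j \in M] then - qhat q * (- q) ^+ between M i j
  else 0.

Definition lop i j : 'M[k]_#|{set 'I_n}| :=
  smx (fun M P => lcoef i j M *+ (P == shift i j M)).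

Lemma lcoef_diag i M : lcoef i i M = q^-1 ^+ (i \in M).
Proof. by rewrite /lcoef eqxx. Qed.

Lemma lcoef_lt i j M : (i < j)%N -> lcoef i j M =
  if (i \notin M) && (j \in M) then - qhat q * (- q) ^+ between M i j else 0.
Proof. by move=> ij; rewrite /lcoef -val_eqE /= ltn_eqF // ij. Qed.

Lemma lcoef_gt i j M : (j < i)%N -> lcoef i j M = 0.
Proof. by move=> ji; rewrite /lcoef -val_eqE /= gtn_eqF // ltnNge (ltnW ji). Qed.

Lemma shift_diag i M : shift i i M = M.
Proof. by rewrite /shift eqxx. Qed.

Lemma shift_lt i j M : (i < j)%N -> shift i j M = i |: (M :\ j).
Proof. by move=> ij; rewrite /shift -val_eqE /= ltn_eqF. Qed.

(** The subtraction does not truncate: if [b] lies between [i] and [j], it is counted in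
    [between M i j]. *)
Lemma between_shift M a b i j : a \notin M -> b \in M ->
  between (a |: (M :\ b)) i j = (between M i j + (i < a < j) - (i < b < j))%N.
Proof.
move=> aM bM; apply/eqP; rewrite -(eqn_add2r (i < b < j)) subnK; last first.
  rewrite (leq_trans _ (leq_addr _ _)) // /between (cardsD1 b) !inE bM /=.
  exact: leq_addr.
apply/eqP; rewrite /between.
rewrite [#|[set t in a |: _ | _]|](cardsD1 a) [#|[set t in M | _]|](cardsD1 b).
rewrite !inE eqxx bM /=.
have -> : [set t in a |: M :\ b | (i < t < j)%N] :\ a = [set t in M | (i < t < j)%N] :\ b.
  apply/setP => t; rewrite !inE; have [->|] /= := eqVneq t a; last by rewrite -!andbA.
  by rewrite (negbTE aM) /= andbF.
by rewrite addnC [in X in (_ + X)%N]addnC addnA.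
Qed.

Lemma between_split M i l m : (i < l < m)%N ->
  (between M i m = between M i l + (l \in M) + between M l m)%N.
Proof.
move=> ilm; rewrite /between.
rewrite (cardsD1 l) !inE ilm andbT addnAC addnC; congr (_ + _)%N.
rewrite -cardsUI [X in (_ + X)%N]eq_card0 ?addn0; last first.
  by move=> t; rewrite !inE; apply/negP; case: (t \in M) => //=; lia.
apply: eq_card => t; rewrite !inE -val_eqE /=; case: (t \in M) => /=; lia.
Qed.

Lemma below_between M i l : i \notin M -> (i < l)%N ->
  below M l = (below M i + between M i l)%N.
Proof.
move=> iM il; rewrite /below /between -cardsUI [X in (_ + X)%N]eq_card0 ?addn0;
  last first.
  by move=> t; rewrite !inE; case: (t \in M); rewrite //=; lia.
apply: eq_card => t; rewrite !inE; have [tM|//] := boolP (t \in M).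
have : t != i by apply: contraNneq iM => <-.
rewrite -val_eqE /=; lia.
Qed.

Lemma between_setD1 M (p : 'I_n) i l : p \in M ->
  between M i l = ((i < p < l) + between (M :\ p) i l)%N.
Proof.
move=> pM; rewrite /between (cardsD1 p) !inE pM /=; congr (_ + _)%N.
by apply: eq_card => t; rewrite !inE andbA.
Qed.

Hypothesis q_neq0 : q != 0.

Definition lcoef2 i j l m M P : k :=
  lcoef i j M * lcoef l m (shift i j M) *+ (P == shift l m (shift i j M)).

Lemma lcoef2_col i l j M P : (i < l)%N ->
  lcoef2 i j l j M P = q * lcoef2 l j i j M P.
Proof.
move=> il; rewrite /lcoef2; have [lj|jl|/val_inj <-] := ltngtP l j.
- have ij := ltn_trans il lj.
  rewrite !lcoef_lt // !shift_lt // !inE !eqxx /=.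
  have -> : (j == i) = false by rewrite -val_eqE gtn_eqF.
  have -> : (j == l) = false by rewrite -val_eqE gtn_eqF.
  by rewrite /= !andbF !mulr0 !mul0rn mulr0.
- by rewrite !(lcoef_gt _ jl) !(mulr0, mul0r) !mul0rn mulr0.
- rewrite !shift_diag lcoef_diag shift_lt // !inE eqxx /=.
  have -> : (l == i) = false by rewrite -val_eqE gtn_eqF.
  rewrite /= mulr1 lcoef_diag -mulrnAr mulrA lcoef_lt //.
  have [lM|lM] := boolP (l \in M); first by rewrite expr1 divff // mul1r.
  by rewrite andbF !mul0rn mulr0.
Qed.

Lemma shift2E (M : {set 'I_n}) a b u v : b != v ->
  a |: ((b |: M :\ u) :\ v) = [set a; b] :|: M :\: [set u; v].
Proof.
move=> bv; apply/setP => t; rewrite !inE negb_or -orbA.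
by have [->|] /= := eqVneq t b; [rewrite bv | rewrite andbA [_ && (t != u)]andbC].
Qed.

(** Triangularity of L kills most products, depending on the order of the indices; the surviving
    ones reach the same set, so that only their scalar coefficients have to be compared. *)
Lemma lcoef2_cross i l j m M P : (i < l)%N -> (j < m)%N ->
  lcoef2 i m l j M P - q * lcoef2 l m i j M P =
  - q * (lcoef2 i j l m M P - q * lcoef2 l j i m M P).
Proof.
move=> il jm.
have neqlt (a b : 'I_n) : (a < b)%N -> ((a == b) = false) * ((b == a) = false).
  by move=> ab; rewrite -!val_eqE ltn_eqF // gtn_eqF.
rewrite /lcoef2; have [ml|lm|/val_inj ml] := ltngtP m l.
- by rewrite !(lcoef_gt _ ml) !(lcoef_gt _ (ltn_trans jm ml)) !(mulr0, mul0r, mul0rn,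
  subr0).
- have im := ltn_trans il lm.
  have [lj|jl|/val_inj lj] := ltngtP l j.
  (* i < l < j < m is the only order in which all four products can be nonzero; [al], [be], [ga]
     below count the elements of [M] in the three gaps. *)
  + have ij := ltn_trans il lj.
    rewrite !lcoef_lt // !shift_lt // !inE !(eqxx, neqlt i l, neqlt i j, neqlt i m,
      neqlt l j, neqlt l m, neqlt j m) //=.
    have [iM|iM] := boolP (i \in M); first by rewrite /= !(mul0r, mulr0, mul0rn, subr0).
    have [lM|lM] := boolP (l \in M); first by rewrite /= !(andbF, mul0r, mulr0, mul0rn,
      subr0).
    have [jM|jM] := boolP (j \in M); last by rewrite /= !(andbF, mul0r, mulr0, mul0rn,
      subr0).
    have [mM|mM] := boolP (m \in M); last by rewrite /= !(andbF, mul0r, mulr0, mul0rn,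
      subr0).
    rewrite /=.
    rewrite !between_shift //.
    have [ilm ilj ljm] : [/\ (i < l < m)%N, (i < l < j)%N & (l < j < m)%N] by rewrite
      il lm lj jm.
    rewrite (between_split M ilm) (between_split M ilj) (between_split M ljm).
    rewrite jM (negbTE lM).
    move: (between M i l) (between M l j) (between M j m) => al be ga.
    have -> : (be + (l < i < j) - (l < m < j) = be)%N by lia.
    have -> : (al + false + be + (i < l < j) - (i < m < j) = (al + be).+1)%N by lia.
    have -> : (be + true + ga + (l < i < m) - (l < j < m) = be + ga)%N by lia.
    have -> : (al + false + (be + true + ga) + (i < l < m) - (i < j < m) = (al + be +
      ga).+1)%N by lia.
    have -> : (al + false + (be + true + ga) = (al + be + ga).+1)%N by lia.
    have -> : (al + false + be = al + be)%N by lia.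
    have -> : (be + true + ga = (be + ga).+1)%N by lia.
    rewrite !shift2E ?(neqlt i j, neqlt i m, neqlt l j, neqlt l m) //.
    rewrite (setUC [set l] [set i]) (setUC [set m] [set j]).
    case: (P == _); rewrite ?mulr1n ?mulr0n ?exprS ?exprD; ring.
  + rewrite !(lcoef_gt _ jl) !(mulr0, mul0r, mul0rn, sub0r, subr0) mulNr;
    congr (- (_ * _)).
    have [ij|ji|/val_inj ij] := ltngtP i j; last 2 first.
    * by rewrite !(lcoef_gt _ ji) !(mulr0, mul0r, mul0rn).
    * rewrite -ij !shift_diag !lcoef_diag !shift_lt // !inE (neqlt i l) // (neqlt i m)
      //=.
      by rewrite mulrC.
    rewrite !lcoef_lt // !shift_lt // !inE !(eqxx, neqlt i l, neqlt i j, neqlt i m,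
      neqlt j l, neqlt l m, neqlt j m) //=.
    have [iM|iM] := boolP (i \in M); first by rewrite /= !(mul0r, mulr0, mul0rn, subr0).
    have [lM|lM] := boolP (l \in M); first by rewrite /= !(andbF, mul0r, mulr0, mul0rn,
      subr0).
    have [jM|jM] := boolP (j \in M); last by rewrite /= !(andbF, mul0r, mulr0, mul0rn,
      subr0).
    have [mM|mM] := boolP (m \in M); last by rewrite /= !(andbF, mul0r, mulr0, mul0rn,
      subr0).
    rewrite /= !shift2E ?(neqlt i l, neqlt i m, neqlt j l, neqlt j m) // !between_shift
      //.
    rewrite (setUC [set l] [set i]) (setUC [set m] [set j]).
    move: (between M i j) (between M l m) => al be.
    have -> : (al + (i < l < j) - (i < m < j) = al)%N by lia.
    have -> : (be + (l < i < m) - (l < j < m) = be)%N by lia.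
    by rewrite mulrC.
  + rewrite -{j}lj in jm *.
    rewrite !shift_diag !lcoef_diag !lcoef_lt // !shift_lt // !inE !(eqxx, neqlt i l,
      neqlt i m, neqlt l m) //=.
    have [iM|iM] := boolP (i \in M); first by rewrite /= !(andbF, mul0r, mulr0, mul0rn,
      subr0).
    have [mM|mM] := boolP (m \in M); last by rewrite /= !(andbF, mul0r, mulr0, mul0rn,
      subr0).
    have ilm : (i < l < m)%N by rewrite il lm.
    have [lM|lM] := boolP (l \in M) => /=.
      rewrite !(mul0r, mul0rn, mulr0, subr0) expr1 shift2E ?neqlt // between_shift //.
      rewrite (between_split M ilm) lM.
      have -> : [set l; i] :|: M :\: [set l; m] = i |: M :\ m.
        apply/setP => t; rewrite !inE negb_or.
        by have [->|] //= := eqVneq t l; rewrite lM (neqlt l m) // orbT.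
      move: (between M i l) (between M l m) => al be.
      have -> : (be + (l < i < m) - (l < l < m) = be)%N by lia.
      rewrite addn1 addSn.
      by case: (P == _); rewrite ?mulr1n ?mulr0n ?exprS ?exprD /qhat; field.
    rewrite !(mul0r, mul0rn, mulr0, subr0, sub0r) expr0 between_shift // setU1K;
      last first.
      by rewrite !inE (negbTE lM) andbF.
    rewrite (between_split M ilm) (negbTE lM).
    move: (between M i l) (between M l m) => al be.
    have -> : (al + (i < l < l) - (i < m < l) = al)%N by lia.
    rewrite addn0.
    by case: (P == _); rewrite ?mulr1n ?mulr0n ?exprS ?exprD /qhat; field.
- rewrite -{l}ml in il *.
  rewrite !(lcoef_gt _ jm) !(mulr0, mul0r, mul0rn, sub0r, subr0) mulNr; congr (- (_ * _)).
  rewrite mulrC !lcoef_diag !shift_diag.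
  have [ij|ji|/val_inj <-] := ltngtP i j.
  + by rewrite shift_lt // !inE !(neqlt i m, neqlt j m).
  + by rewrite !(lcoef_gt _ ji) !(mul0r, mul0rn).
  + by rewrite shift_diag.
Qed.

Lemma lopM i j l m M P :
  (lop i j * lop l m) (enum_rank M) (enum_rank P) = lcoef2 i j l m M P.
Proof.
rewrite smx_mulE (bigD1 (shift i j M)) //= big1 ?addr0 => [|Q QM].
  by rewrite !smxE eqxx mulrnAr.
by rewrite smxE (negbTE QM) mul0r.
Qed.

Lemma lop_column_relations : column_relations (- q)%:M lop.
Proof.
have cE (A : 'M[k]_#|{set 'I_n}|) M P :
    ((- q)%:M * A) (enum_rank M) (enum_rank P) = - q * A (enum_rank M) (enum_rank P).
  by rewrite -[_ * A]/(_ *m A) mul_scalar_mx mxE.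
have oppE (A : 'M[k]_#|{set 'I_n}|) M P :
    (- A) (enum_rank M) (enum_rank P) = - A (enum_rank M) (enum_rank P).
  by rewrite mxE.
have addE (A B : 'M[k]_#|{set 'I_n}|) M P :
    (A + B) (enum_rank M) (enum_rank P) =
    A (enum_rank M) (enum_rank P) + B (enum_rank M) (enum_rank P).
  by rewrite mxE.
split=> [i l j il|i l j m il jm]; apply: smxP => M P.
  by rewrite oppE cE !lopM mulNr opprK; apply: lcoef2_col.
by rewrite !(addE, cE) !lopM !mulNr lcoef2_cross // mulNr.
Qed.

End LOperators.

(** * Moving an L-operator through a minor *)

Section LinearCombinations.
Variables (k : comNzRingType) (V : lmodType k) (u v w : V).

Definition lc3 a b c : V := a *: u + b *: v + c *: w.

Lemma lc3D a b c a' b' c' : lc3 a b c + lc3 a' b' c' = lc3 (a + a') (b + b') (c + c').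
Proof. by rewrite /lc3 !scalerDl addrACA; congr (_ + _); rewrite addrACA. Qed.

Lemma lc3N a b c : - lc3 a b c = lc3 (- a) (- b) (- c).
Proof. by rewrite /lc3 !scaleNr !opprD. Qed.

Lemma lc3Z e a b c : e *: lc3 a b c = lc3 (e * a) (e * b) (e * c).
Proof. by rewrite /lc3 !scalerDr !scalerA. Qed.

(** Writes the vectors as coordinate combinations, a form stable under sums, opposites and scalings,
    so that rewriting alone collects coefficients. *)
Lemma lc3_coordinates (P : V -> V -> V -> Prop) :
  P (lc3 1 0 0) (lc3 0 1 0) (lc3 0 0 1) -> P u v w.
Proof. by rewrite /lc3 !scale1r !scale0r !addr0 !add0r. Qed.

End LinearCombinations.

(* Reduces a linear identity between [u], [v] and [w] to identities between
   the coefficients. *)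
Ltac lincomb u v w :=
  move: u v w;
  let u' := fresh in let v' := fresh in let w' := fresh in
  intros u' v' w'; pattern u', v', w'; apply: lc3_coordinates;
  rewrite !(lc3Z, lc3N, lc3D); apply: f_equal3.

(** * Commuting sum_l L_il x_lj with the coaction of a generator *)

Section Exchange.
Variables (k : fieldType) (n : nat) (q : k) (A : algType k).
Hypothesis q_neq0 : q != 0.
Variable x : 'I_n -> 'I_n -> A.
Implicit Types (M N : {set 'I_n}) (i j l m p s : 'I_n) (f : {set 'I_n} -> A).

Definition qmatrix_relations : Prop :=
  [/\ forall i l j, (i < l)%N -> x i j * x l j = q *: (x l j * x i j),
      forall i j m, (j < m)%N -> x i j * x i m = q *: (x i m * x i j),
      forall i j l m, (i < l)%N -> (m < j)%N -> x i j * x l m = x l m * x i j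
    & forall i j l m, (i < l)%N -> (j < m)%N ->
        x i j * x l m = x l m * x i j + qhat q *: (x i m * x l j)].

Hypothesis qrel : qmatrix_relations.

Let col i l j : (i < l)%N -> x i j * x l j = q *: (x l j * x i j).
Proof. by case: qrel => + _ _ _; apply. Qed.

Let row i j m : (j < m)%N -> x i j * x i m = q *: (x i m * x i j).
Proof. by case: qrel => _ + _ _; apply. Qed.

Let comm i j l m : (i < l)%N -> (m < j)%N -> x i j * x l m = x l m * x i j.
Proof. by case: qrel => _ _ + _; apply. Qed.

Let cross i j l m : (i < l)%N -> (j < m)%N ->
  x i j * x l m = x l m * x i j + qhat q *: (x i m * x l j).
Proof. by case: qrel => _ _ _; apply. Qed.

Local Notation c := ((- q)%:A : A).

Lemma central_scalar (y : A) : c * y = y * c.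
Proof. by rewrite mulr_algl mulr_algr. Qed.

Lemma scalarXM r (y : A) : c ^+ r * y = (- q) ^+ r *: y.
Proof. by rewrite -(rmorphXn (GRing.in_alg A)) /= mulr_algl. Qed.

Lemma qmatrix_column_relations : column_relations c x.
Proof.
split=> [i l j il|i l j m il jm].
  by rewrite mulr_algl scaleNr opprK; apply: col.
rewrite 2!mulr_algl mulr_algl.
rewrite (cross il jm) (comm il jm).
lincomb (x l j * x i m) (x l m * x i j) (0 : A); rewrite /qhat; by field.
Qed.

Let scalC (e1 e2 : k) (y : A) : e1 *: (e2 *: y) = e2 *: (e1 *: y).
Proof. by rewrite !scalerA mulrC. Qed.

(* The action of sum_l L_il x_lj on vectors indexed by sets of rows. *)
Definition yop i j f M : A := \sum_l lcoef q i l M *: (x l j * f (shift i l M)).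

Lemma yop_in i j f M : i \in M -> yop i j f M = q^-1 *: (x i j * f M).
Proof.
move=> iM; rewrite /yop (bigD1 i) //= big1 ?addr0.
  by rewrite lcoef_diag iM expr1 shift_diag.
move=> l li; have [il|li'|/val_inj lE] := ltngtP i l.
- by rewrite lcoef_lt // iM scale0r.
- by rewrite lcoef_gt ?scale0r.
- by rewrite lE eqxx in li.
Qed.

Lemma yop_notin i j f M : i \notin M ->
  yop i j f M = x i j * f M +
    \sum_(l in M | (i < l)%N)
       (- qhat q * (- q) ^+ between M i l) *: (x l j * f (i |: M :\ l)).
Proof.
move=> iM; rewrite /yop (bigD1 i) //= lcoef_diag (negbTE iM) expr0 scale1r shift_diag.
congr (_ + _); rewrite [RHS]big_mkcond [LHS]big_mkcond; apply: eq_bigr => l _.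
have [il|li|/val_inj lE] := ltngtP i l.
- by rewrite -val_eqE /= gtn_eqF // lcoef_lt // iM shift_lt // andbT /=; case: ifP;
  rewrite ?scale0r.
- by rewrite andbF lcoef_gt // scale0r if_same.
- by rewrite -lE eqxx andbF.
Qed.

(** After [i] is deleted, the off-diagonal part of [yop] may put it back in place of some larger
    [p]. The net effect is the deletion of [p], which accounts for the [qhat] term. *)
Lemma wop_yop_in i j s f M : i \in M ->
  wop c x s (yop i j f) M = \sum_(p in M) (- q) ^+ below M p *:
    ((if p == i then x i s * x i j
      else q^-1 *: (x p s * x i j + (if (i < p)%N then qhat q *: (x i s * x p j) else 0)))
     * f (M :\ p)).
Proof.
move=> iM; rewrite /wop (bigD1 i) //= [in RHS](bigD1 i) //= eqxx.
rewrite yop_notin ?setD11 // mulrDr -!mulrA !scalarXM -addrA; congr (_ + _).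
transitivity (\sum_(p in M | p != i)
    ((- q) ^+ below M p *: (if (i < p)%N then (q^-1 * qhat q) *: (x i s * x p j * f (M
      :\ p)) else 0)
     + (- q) ^+ below M p *: (q^-1 *: (x p s * x i j * f (M :\ p))))); last first.
  apply: eq_bigr => p /andP[pM pi]; rewrite (negbTE pi) -scalerDr; congr (_ *: _).
  rewrite addrC -scalerAl mulrDl scalerDr; congr (_ + _); case: ifP => _.
    by rewrite -scalerAl scalerA.
  by rewrite mul0r scaler0.
rewrite big_split; congr (_ + _); last first.
  apply: eq_bigr => p /andP[pM pi].
  by rewrite yop_in ?inE 1?eq_sym ?pi // -mulrA scalarXM -scalerAr mulrA.
rewrite !mulr_sumr scaler_sumr.
rewrite [RHS](bigID (fun p : 'I_n => (i < p)%N)) /= [X in _ = _ + X]big1 ?addr0;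
  last first.
  by move=> p /andP[_ /negbTE->]; rewrite scaler0.
apply: eq_big => [p|p]; first by rewrite !inE -[_ && (p \in M)]andbC.
rewrite !inE => /andP[/andP[pi pM] ip]; rewrite ip.
have -> : i |: M :\ i :\ p = M :\ p.
  apply/setP => t; rewrite !inE; have [->|//] := eqVneq t i.
  by rewrite iM eq_sym pi.
rewrite -!scalerAr !scalerA -[x i s * x p j * _]mulrA; congr (_ *: _).
rewrite (below_setD1 p iM) ip (below_between _ ip) ?setD11 // (below_setD1 i iM) ltnn.
by rewrite !exprD expr1 expr0; field.
Qed.

(** In the double sum, [p] is the deleted row and [l] the row replaced by [i]; [yop_wop_notin] uses
    the same indexing, for comparison term by term. *)
Lemma wop_yop_notin i j s f M : i \notin M ->
  wop c x s (yop i j f) M =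
    \sum_(p in M) (- q) ^+ below M p *: (x p s * x i j * f (M :\ p))
    + \sum_(l in M | (i < l)%N) \sum_(p in M | p != l)
        (- qhat q * (- q) ^+ (below M p + between (M :\ p) i l)) *:
           (x p s * x l j * f (i |: M :\ p :\ l)).
Proof.
move=> iM; rewrite /wop.
transitivity (\sum_(p in M) ((- q) ^+ below M p *: (x p s * x i j * f (M :\ p))
   + \sum_(l in M :\ p | (i < l)%N)
       (- qhat q * (- q) ^+ (below M p + between (M :\ p) i l)) *:
           (x p s * x l j * f (i |: M :\ p :\ l)))).
  apply: eq_bigr => p pM; rewrite -mulrA scalarXM yop_notin; last first.
    by rewrite !inE (negbTE iM) andbF.
  rewrite mulrDr scalerDr mulrA; congr (_ + _); rewrite mulr_sumr scaler_sumr.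
  apply: eq_bigr => l _; rewrite -scalerAr scalerA -[x p s * x l j * _]mulrA.
  by congr (_ *: _); rewrite exprD; ring.
rewrite big_split; congr (_ + _).
rewrite (exchange_big_dep (fun l : 'I_n => (l \in M) && (i < l)%N)) /=; last first.
  by move=> p l pM; rewrite !inE => /andP[/andP[_ ->] ->].
apply: eq_bigr => l /andP[lM il]; apply: eq_bigl => p.
by rewrite !inE lM il !andbT eq_sym.
Qed.

Lemma yop_wop_in i j s f M : i \in M ->
  yop i j (wop c x s f) M = \sum_(p in M) (- q) ^+ below M p *:
    (q^-1 *: (x i j * x p s) * f (M :\ p)).
Proof.
move=> iM; rewrite yop_in // /wop mulr_sumr scaler_sumr; apply: eq_bigr => p pM.
by rewrite -!mulrA scalarXM -scalerAr -scalerAl scalC -!mulrA.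
Qed.

Lemma yop_wop_notin i j s f M : i \notin M ->
  yop i j (wop c x s f) M =
    \sum_(p in M) (- q) ^+ below M p *:
      ((x i j * x p s - (if (i < p)%N then qhat q *: (x p j * x i s) else 0)) * f (M :\
        p))
    + \sum_(l in M | (i < l)%N) \sum_(p in M | p != l)
        (- qhat q * (- q) ^+ (between M i l + below (i |: M :\ l) p)) *:
           (x l j * x p s * f (i |: M :\ p :\ l)).
Proof.
move=> iM; rewrite yop_notin // /wop.
under [X in _ + X]eq_bigr => l /andP[lM il].
  have iMl : i \notin M :\ l by rewrite !inE (negbTE iM) andbF.
  rewrite (big_setU1 _ iMl) /= mulrDr scalerDr setU1K // below_setU1 // ltnn add0n.
  over.
rewrite big_split addrA; congr (_ + _).
  rewrite mulr_sumr [X in _ + X]big_mkcondr /= -big_split; apply: eq_bigr => p pM /=.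
  rewrite -mulrA scalarXM -scalerAr mulrBl scalerBr mulrA; congr (_ + _).
  case: ifP => ip; last by rewrite mul0r scaler0 oppr0.
  rewrite -!mulrA scalarXM -scalerAr -scalerAl -scaleNr !scalerA -!mulrA.
  congr (_ *: _); rewrite -exprD [LHS]mulrC mulrN mulNr; congr (- (_ ^+ _ * _)).
  by rewrite (below_between iM ip) (below_setD1 i pM) [(p < i)%N]ltnNge (ltnW ip) addnC.
apply: eq_bigr => l /andP[lM il]; rewrite mulr_sumr scaler_sumr.
apply: eq_big => [p|p]; first by rewrite !inE andbC.
rewrite !inE => /andP[pl pM].
have -> : (i |: M :\ l) :\ p = i |: M :\ p :\ l.
  apply/setP => t; rewrite !inE; have [->|] := eqVneq t i; last by rewrite /= andbCA.
  by rewrite /= andbT; apply: contraNneq iM => ->.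
by rewrite -!mulrA scalarXM -scalerAr scalerA -mulrA -exprD mulrA.
Qed.

(** When both rows lie above [i], the terms (l, p) and (p, l) reach the same set and only their sum
    commutes as wanted, so they are grouped. *)
Lemma sum_pairs_above (i : 'I_n) (M : {set 'I_n}) (g : 'I_n -> 'I_n -> A) : i \notin M ->
  \sum_(l in M | (i < l)%N) \sum_(p in M | p != l) g l p =
  \sum_(l in M | (i < l)%N) (\sum_(p in M | (p < i)%N) g l p
    + \sum_(p in M | (l < p)%N) (g l p + g p l)).
Proof.
move=> iM; rewrite big_split /=.
under [X in _ = _ + X]eq_bigr => l _ do rewrite big_split.
rewrite big_split /= addrA.
have -> : \sum_(l in M | (i < l)%N) \sum_(p in M | (l < p)%N) g p l =
    \sum_(l in M | (i < l)%N) \sum_(p in M | (i < p < l)%N) g l p.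
  rewrite (exchange_big_dep (fun p : 'I_n => (p \in M) && (i < p)%N)) /=; last first.
    by move=> l p /andP[_ il] /andP[-> /(ltn_trans il)].
  apply: eq_bigr => l /andP[lM il]; apply: eq_bigl => p.
  by rewrite lM -andbA.
rewrite -!big_split; apply: eq_bigr => l /andP[lM il] /=.
rewrite (bigID (fun p : 'I_n => (p < i)%N)) /= -addrA; congr (_ + _).
  apply: eq_bigl => p; rewrite -andbA; congr (_ && _); rewrite -val_eqE /=; lia.
rewrite (bigID (fun p : 'I_n => (l < p)%N)) /=.
have ne p : p \in M -> (p : nat) != i.
  by move=> pM; apply: contraNneq iM => /val_inj <-.
congr (_ + _); apply: eq_bigl => p; have [/ne|//] := boolP (p \in M);
  rewrite -?val_eqE /=; lia.
Qed.

(* The three relative positions of [j] and [s] satisfy R1-R5 for different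
   values of [a] and [b], so the commutation is computed once. *)
Section Step.
Variables (j s : 'I_n) (a b : k).
Hypothesis R1 : forall i p, (p < i)%N ->
  x i j * x p s = a *: (x p s * x i j) + b *: (x p j * x i s).
Hypothesis R2 : forall i,
  q^-1 *: (x i j * x i s) = a *: (x i s * x i j) + b *: (x i j * x i s).
Hypothesis R3 : forall i p, (i < p)%N ->
  x i j * x p s = a *: (x p s * x i j + qhat q *: (x i s * x p j))
                + b *: (x p j * x i s + qhat q *: (x i j * x p s)).
Hypothesis R4 : forall i p, (i < p)%N ->
  x i j * x p s - qhat q *: (x p j * x i s) =
  a *: (x p s * x i j) + b *: (x p j * x i s).
Hypothesis R5 : forall i p, (i < p)%N ->
  x i j * x p s - q *: (x p j * x i s) =
  a *: (x p s * x i j - q^-1 *: (x i s * x p j))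
  + b *: (x p j * x i s - q^-1 *: (x i j * x p s)).

(** Coefficients of the same value of [f] are compared. For a deleted row p, [R1] serves p < i, [R2]
    serves p = i, and [R3] or [R4] serves i < p, according to whether [i] is in [M]. For a deletion
    with a replacement, [R1] applies if p < i, and [R5] treats both orders of a pair above [i] at
    once. *)
Lemma yop_wop_step i f M : yop i j (wop c x s f) M =
  a *: wop c x s (yop i j f) M + b *: wop c x j (yop i s f) M.
Proof.
have [iM|iM] := boolP (i \in M).
  rewrite yop_wop_in // !wop_yop_in // !scaler_sumr -big_split; apply: eq_bigr => p pM.
  rewrite /= (scalC a) (scalC b) -scalerDr; congr (_ *: _).
  rewrite (scalerAl a) (scalerAl b) -mulrDl; congr (_ * _).
  have [pi|ip|/val_inj pi] := ltngtP p i.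
  - by rewrite -!val_eqE /= ltn_eqF // !addr0 [in LHS]R1 // scalerDr !(scalC q^-1).
  - by rewrite -!val_eqE /= gtn_eqF // [in LHS]R3 // scalerDr !(scalC q^-1).
  - by rewrite -pi eqxx R2.
rewrite yop_wop_notin // !wop_yop_notin // !scalerDr addrACA; congr (_ + _).
  rewrite !scaler_sumr -big_split; apply: eq_bigr => p pM.
  rewrite /= (scalC a) (scalC b) -scalerDr; congr (_ *: _).
  rewrite (scalerAl a) (scalerAl b) -mulrDl; congr (_ * _).
  case: ifP => ip; first exact: R4.
  rewrite subr0 R1 //; rewrite ltn_neqAle leqNgt ip andbT.
  by apply: contraNneq iM => /val_inj <-.
rewrite !sum_pairs_above // !scaler_sumr -big_split; apply: eq_bigr => l /andP[lM il].
rewrite /= !scalerDr addrACA; congr (_ + _).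
  rewrite !scaler_sumr -big_split; apply: eq_bigr => p /andP[pM pi].
  have -> : below (i |: M :\ l) p = below M p.
    rewrite below_setU1 ?inE ?(negbTE iM) ?andbF // (below_setD1 p lM).
    by rewrite !ltnNge (ltnW pi) (ltnW (ltn_trans pi il)).
  have -> : between (M :\ p) i l = between M i l.
    by rewrite [RHS](between_setD1 i l pM) ltnNge (ltnW pi).
  rewrite /= (scalC a) (scalC b) addnC -scalerDr; congr (_ *: _).
  by rewrite (scalerAl a) (scalerAl b) -mulrDl R1 // (ltn_trans pi il).
rewrite !scaler_sumr -big_split; apply: eq_bigr => p /andP[pM lp].
have -> : M :\ l :\ p = M :\ p :\ l by rewrite !setDDl setUC.
have ip := ltn_trans il lp; have ilp : (i < l < p)%N by rewrite il.
have E1 : below M p = (below M l + between M l p).+1.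
  rewrite (below_setD1 p lM) lp (below_between _ lp) ?setD11 //.
  by rewrite (below_setD1 l lM) (between_setD1 l p lM) ltnn.
have E2 : below (i |: M :\ l) p = below M p.
  by rewrite below_setU1 ?inE ?(negbTE iM) ?andbF // (below_setD1 p lM) ip lp.
have E3 : below (i |: M :\ p) l = (below M l).+1.
  rewrite below_setU1 ?inE ?(negbTE iM) ?andbF // (below_setD1 l pM) il.
  by rewrite [(p < l)%N]ltnNge (ltnW lp).
have E4 : between (M :\ p) i l = between M i l.
  by rewrite [RHS](between_setD1 i l pM) [(p < l)%N]ltnNge (ltnW lp) andbF.
have E5 : between M i p = (between (M :\ l) i p).+1 by rewrite (between_setD1 i p lM) ilp.
have E6 : between (M :\ l) i p = (between M i l + between M l p)%N.
  by apply/eqP; rewrite -eqSS -E5 (between_split M ilp) lM addn1.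
rewrite E2 E3 E4 E5 E6 E1.
(* Exchanging the deleted and the replaced row multiplies the common factor [e] by -q on the left
   and by -1/q on the right: the factors built into [R5]. *)
set e := - qhat q * (- q) ^+ (between M i l + (below M l + between M l p).+1).
have -> : - qhat q * (- q) ^+ ((between M i l + between M l p).+1 + (below M l).+1) = e
  * - q.
  by rewrite /e -mulrA -exprSr; congr (_ * _ ^+ _); lia.
have -> : - qhat q * (- q) ^+ (below M l + (between M i l + between M l p)) = e * - q^-1.
  have -> : e = - qhat q * (- q) ^+ (below M l + (between M i l + between M l p)).+1.
    by rewrite /e; congr (_ * _ ^+ _); lia.
  by rewrite exprS; field.
have -> : - qhat q * (- q) ^+ ((below M l + between M l p).+1 + between M i l) = e.
  by rewrite addnC.
clearbody e; rewrite /= -!scalerA -!scalerDr (scalC a) (scalC b) -scalerDr;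
  congr (_ *: _).
rewrite !scaleNr (scalerAl q (x p j * x l s)) (scalerAl q^-1 (x l s * x p j)).
rewrite (scalerAl q^-1 (x l j * x p s)) -!mulrBl (scalerAl a) (scalerAl b) -mulrDl.
by rewrite R5.
Qed.

End Step.

(** Here and in the next two lemmas, [a] and [b] are the coefficients that the L-operators have on
    singletons: 1 or 1/q on the diagonal, 0 or -[qhat] off it. *)
Lemma yop_wop_gt i j s f M : (j < s)%N ->
  yop i j (wop c x s f) M = wop c x s (yop i j f) M.
Proof.
move=> js; rewrite (@yop_wop_step j s 1 0) ?scale1r ?scale0r ?addr0 //.
- by move=> l p pl; rewrite scale1r scale0r addr0 (comm pl js).
- move=> l; rewrite (row _ js).
  lincomb (x l s * x l j) (0 : A) (1 : A); by field.
- by move=> l p lp; rewrite scale1r scale0r addr0 cross.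
- move=> l p lp; rewrite (cross lp js) (comm lp js).
  by rewrite scale1r scale0r addr0 addrK.
- move=> l p lp; rewrite (cross lp js) (comm lp js).
  lincomb (x p j * x l s) (x p s * x l j) (0 : A); rewrite /qhat; by field.
Qed.

Lemma yop_wop_eq i j f M :
  yop i j (wop c x j f) M = q^-1 *: wop c x j (yop i j f) M.
Proof.
rewrite (@yop_wop_step j j q^-1 0) ?scale0r ?addr0 //.
- by move=> l p pl; rewrite (col _ pl) scale0r addr0 scalerA mulVf // scale1r.
- by move=> l; rewrite scale0r addr0.
- move=> l p lp; rewrite (col _ lp).
  lincomb (x p j * x l j) (0 : A) (1 : A); rewrite /qhat; by field.
- move=> l p lp; rewrite (col _ lp).
  lincomb (x p j * x l j) (0 : A) (1 : A); rewrite /qhat; by field.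
- move=> l p lp; rewrite (col _ lp).
  lincomb (x p j * x l j) (0 : A) (1 : A); by field.
Qed.

Lemma yop_wop_lt i j s f M : (s < j)%N ->
  yop i j (wop c x s f) M =
  wop c x s (yop i j f) M - qhat q *: wop c x j (yop i s f) M.
Proof.
move=> sj; rewrite (@yop_wop_step j s 1 (- qhat q)) ?scale1r ?scaleNr //.
- by move=> l p pl; rewrite (cross pl sj) scale1r scaleNr addrK.
- move=> l; rewrite (row _ sj).
  lincomb (x l j * x l s) (0 : A) (1 : A); rewrite /qhat; by field.
- move=> l p lp; rewrite (cross lp sj) (comm lp sj).
  lincomb (x p j * x l s) (x p s * x l j) (0 : A); rewrite /qhat; by field.
- by move=> l p lp; rewrite (comm lp sj) scale1r scaleNr.
- move=> l p lp; rewrite (cross lp sj) (comm lp sj).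
  lincomb (x p j * x l s) (x p s * x l j) (0 : A); rewrite /qhat; by field.
Qed.

End Exchange.

(** * The commutation relation *)

Section Morphism.
Variables (n : nat) (R S : pzRingType) (g : {rmorphism R -> S}).
Variables (c : R) (x : 'I_n -> 'I_n -> R).

Lemma rmorph_wminor (I J : {set 'I_n}) :
  g (wminor c x I J) = wminor (g c) (fun i j => g (x i j)) I J.
Proof.
rewrite /wminor; elim: (enum J) I => [|j js IH] I /=; first by rewrite rmorph_nat.
by rewrite rmorph_sum; apply: eq_bigr => i _; rewrite !rmorphM rmorphXn IH.
Qed.

Lemma rmorph_column_relations :
  column_relations c x -> column_relations (g c) (fun i j => g (x i j)).
Proof.
case=> col cross; split=> [i l j il|i l j m il jm].
  by rewrite -!rmorphM -rmorphN col.
by rewrite -!rmorphM -!rmorphD -!rmorphM cross.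
Qed.

End Morphism.

(** * The intertwining relation and the exchange of two minors *)

Section Braiding.
Variables (k : fieldType) (n : nat) (q : k) (A : algType k).
Hypothesis q_neq0 : q != 0.
Variable x : 'I_n -> 'I_n -> A.
Hypothesis qrel : qmatrix_relations q x.
Implicit Types (M N L K I J : {set 'I_n}) (i j l m p s : 'I_n).

Local Notation c := ((- q)%:A : A).
Local Notation minor := (wminor c x).

Let colx : column_relations c x := qmatrix_column_relations q_neq0 qrel.
Let cC := @central_scalar k q A.

(** The right side is an entry of T (sum_l X_il L_lj). The operator is moved past the smallest
    column [n0] of [N]; if n0 < j, the extra term of [yop_wop_lt] is the summand l = [n0], and it
    vanishes when [j] is already in [N]. *)
Lemma yop_wminor i j N M :
  yop q x i j (minor^~ N) M =
  if j \in N then q^-1 *: (minor M N * x i j)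
  else minor M N * x i j + \sum_(l in N | (l < j)%N)
      (- qhat q * (- q) ^+ between N l j) *: (minor M (j |: N :\ l) * x i l).
Proof.
elim/set_min_ind: N i j M => [|n0 N n0N IH] i j M.
  rewrite inE big_pred0 ?addr0 => [|l]; last by rewrite inE.
  have [iM|iM] := boolP (i \in M).
    rewrite yop_in // wminor0; have -> : (M == set0) = false.
      by apply/negP => /eqP M0; rewrite M0 inE in iM.
    by rewrite mulr0 mul0r scaler0.
  rewrite yop_notin // big1 => [|l _]; first by rewrite addr0 wminor0 mulr_natl mulr_natr.
  rewrite wminor0; have -> : (i |: M :\ l == set0) = false.
    by apply/negP => /eqP M0; have := setU11 i (M :\ l); rewrite M0 inE.
  by rewrite mulr0 scaler0.
have n0nN : n0 \notin N by apply/negP => /n0N; rewrite ltnn.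
have -> : yop q x i j (minor^~ (n0 |: N)) M = yop q x i j (wop c x n0 (minor^~ N)) M.
  by apply: eq_bigr => l _; rewrite wminorU1.
have [jn0|n0j|/val_inj jn0] := ltngtP j n0.
- have jN : j \notin N by apply/negP => /n0N /(ltn_trans jn0); rewrite ltnn.
  have sum0 (G : 'I_n -> A) S : (forall l, l \in S -> (n0 <= l)%N) ->
      \sum_(l in S | (l < j)%N) G l = 0.
    move=> n0S; apply: big_pred0 => l; apply/negP => /andP[/n0S]; lia.
  rewrite yop_wop_gt // (eq_wop _ _ _ _ (fun M => IH i j M)) !inE (negbTE jN).
  rewrite -val_eqE /= ltn_eqF //= sum0; last first.
    by move=> l; rewrite !inE => /predU1P[->//|/n0N/ltnW].
  rewrite addr0 wminorU1 // -wopMr; apply: eq_wop => M'.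
  by rewrite sum0 ?addr0 // => l /n0N/ltnW.
- rewrite yop_wop_lt // (eq_wop _ _ _ _ (fun M => IH i j M)).
  rewrite (eq_wop _ _ _ _ (fun M => IH i n0 M)) !inE (negbTE n0nN).
  rewrite -val_eqE /= gtn_eqF //=.
  have -> : wop c x j (fun M => minor M N * x i n0 +
      \sum_(l in N | (l < n0)%N) (- qhat q * (- q) ^+ between N l n0) *:
         (minor M (n0 |: N :\ l) * x i l)) M = wop c x j (minor^~ N) M * x i n0.
    rewrite -wopMr; apply: eq_wop => M'; rewrite big_pred0 ?addr0 // => l.
    by apply/negP => /andP[/n0N lt]; rewrite ltnNge (ltnW lt).
  rewrite (wop_wminor cC colx).
  have [jN|jN] := boolP (j \in N).
    rewrite mul0r scaler0 subr0 wminorU1 // -wopMr.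
    rewrite [RHS]scaler_sumr; apply: eq_bigr => l _.
    by rewrite -scalerAr.
  rewrite wopD wopMr -wminorU1 // -addrA; congr (_ + _).
  rewrite [RHS]big_mkcondr (big_setU1 _ n0nN) /= n0j -big_mkcondr /= addrC; congr (_ + _).
    rewrite setU1K // scalarXM -scalerAl scalerA -scaleNr mulNr;
      congr (- (_ * _ ^+ _) *: _).
    apply: eq_card => t; rewrite !inE; have [->|tn0] /= := eqVneq t n0.
      by rewrite ltnn (negbTE n0nN).
    by have [/n0N->|] := boolP (t \in N).
  rewrite wop_sum; apply: eq_bigr => l /andP[lN lj].
  have n0l : n0 != l by apply: contraNneq n0nN => ->.
  have -> : j |: (n0 |: N) :\ l = n0 |: (j |: N :\ l).
    apply/setP => t; rewrite !inE; have [->|] //= := eqVneq t n0.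
    by rewrite n0l orbT.
  have -> : between (n0 |: N) l j = between N l j.
    apply: eq_card => t; rewrite !inE; have [->|//] /= := eqVneq t n0.
    by rewrite (negbTE n0nN) ltnNge (ltnW (n0N _ lN)).
  rewrite wminorU1; last first.
    by move=> t; rewrite !inE => /predU1P[->//|/andP[_ /n0N]].
  rewrite -wopMr /wop scaler_sumr; apply: eq_bigr => p _.
  by rewrite -scalerAr.
- rewrite jn0 yop_wop_eq // setU11 (eq_wop _ _ _ _ (fun M => IH i n0 M)).
  congr (_ *: _); rewrite (negbTE n0nN) wminorU1 // -wopMr; apply: eq_wop => M'.
  rewrite big_pred0 ?addr0 // => l; apply/negP => /andP[/n0N lt].
  by rewrite ltnNge (ltnW lt).
Qed.

Local Notation D := {set 'I_n}.
Local Notation T := (smx (fun M N : D => minor M N)).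
Local Notation Lmx := (fun i j => map_mx (GRing.in_alg A) (lop q i j)).
Local Notation Xmx := (fun i j => (x i j)%:M : 'M[A]_#|D|).

(** Reads L by columns: off the diagonal, the only row that can reach [N] is [j |: N :\ l]. *)
Lemma sum_lcoef_column l j N (F : D -> A) :
  \sum_P (lcoef q l j P *+ (N == shift l j P)) *: F P =
  if l == j then q^-1 ^+ (j \in N) *: F N
  else if [&& (l < j)%N, l \in N & j \notin N] then
    (- qhat q * (- q) ^+ between N l j) *: F (j |: N :\ l)
  else 0.
Proof.
have [lj|jl|/val_inj ->] := ltngtP l j.
- rewrite -val_eqE /= ltn_eqF //.
  have jl : (j == l) = false by rewrite -val_eqE gtn_eqF.
  have ljF : (l == j) = false by rewrite eq_sym.
  have [/andP[lN jN]|lNjN] := ifP.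
    rewrite (bigD1 (j |: N :\ l)) //= big1 ?addr0 => [|P PN].
      rewrite shift_lt // lcoef_lt // !inE eqxx jl ljF /= between_shift // ltnn andbF
        ltnn /=.
      rewrite addn0 subn0.
      have -> : (j |: N :\ l) :\ j = N :\ l by rewrite setU1K // !inE jl /= (negbTE jN).
      by rewrite setD1K // !eqxx.
    rewrite shift_lt // lcoef_lt //; case: ifP => [/andP[lP jP]|_];
      last by rewrite mul0rn scale0r.
    have [NE|_] := eqVneq; last by rewrite scale0r.
    case/eqP: PN; rewrite NE setU1K ?setD1K // !inE (negbTE lP) andbF //.
  apply: big1 => P _; rewrite shift_lt // lcoef_lt //.
  case: ifP => [/andP[lP jP]|_]; last by rewrite mul0rn scale0r.
  have [NE|_] := eqVneq; last by rewrite scale0r.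
  by move: lNjN; rewrite NE !inE !eqxx jl.
- rewrite -val_eqE /= gtn_eqF //; apply: big1 => P _.
  by rewrite lcoef_gt // mul0rn scale0r.
- rewrite eqxx (bigD1 N) //= big1 ?addr0 => [|P PN];
  rewrite shift_diag ?eqxx ?lcoef_diag //.
  by rewrite eq_sym (negbTE PN) scale0r.
Qed.

Lemma lop_intertwine i j :
  (\sum_l Lmx i l * Xmx l j) * T = T * (\sum_l Xmx i l * Lmx l j).
Proof.
apply: smxP => M N.
transitivity (yop q x i j (minor^~ N) M).
  rewrite mulr_suml summxE; apply: eq_bigr => l _.
  rewrite -mulrA smx_mulE (bigD1 (shift i l M)) //= big1 ?addr0 => [|P PM].
    rewrite -[Xmx l j * _]/(_ *m _) mul_scalar_mx !mxE !enum_rankK eqxx.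
    by rewrite /= mulr_algl.
  by rewrite !mxE !enum_rankK (negbTE PM) rmorph0 mul0r.
rewrite yop_wminor mulr_sumr summxE.
transitivity (\sum_l \sum_P (lcoef q l j P *+ (N == shift l j P)) *: (minor M P * x i
  l)); last first.
  apply: eq_bigr => l _; rewrite mulrA smx_mulE; apply: eq_bigr => P _.
  rewrite -[_ * Xmx i l]/(_ *m _) -diag_const_mx mul_mx_diag !mxE !enum_rankK /=.
  by rewrite -mulrA mulr_algr scalerAr.
rewrite (eq_bigr _ (fun l _ => sum_lcoef_column l j N (fun P => minor M P * x i l))) /=.
rewrite [RHS](bigD1 j) //= eqxx.
have [jN|jN] := boolP (j \in N).
  by rewrite big1 ?addr0 // => l lj; rewrite (negbTE lj) !andbF.
rewrite expr0 scale1r; congr (_ + _); rewrite [LHS]big_mkcond [RHS]big_mkcond.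
apply: eq_bigr => l _; have [->|lj] /= := eqVneq l j; first by rewrite ltnn andbF.
by rewrite andbT andbC.
Qed.

Definition rcoef I K M P : k :=
  wminor (- q)%:M (lop q) I K (enum_rank M) (enum_rank P).

(** Over matrices with entries in A, the L-operators have constant entries and the generators are
    scalar matrices, so the two families commute and Cauchy-Binet applies to both sides of
    [lop_intertwine]. *)
Lemma wminor_exchange I J M N :
  \sum_K \sum_P rcoef I K M P *: (minor K J * minor P N) =
  \sum_K \sum_P rcoef K J P N *: (minor M P * minor I K).
Proof.
pose C : 'M[A]_#|D| := (- q)%:A%:M.
have CC B : C * B = B * C.
  apply/matrixP => a b; rewrite -[C * B]/(_ *m _) mul_scalar_mx.
  by rewrite -[B * C]/(_ *m _) /C -diag_const_mx mul_mx_diag !mxE cC.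
have Lg (I' K' : D) : wminor C Lmx I' K' =
    map_mx (GRing.in_alg A) (wminor (- q)%:M (lop q) I' K').
  by rewrite (rmorph_wminor (map_mx (GRing.in_alg A))) /= map_scalar_mx.
have Xg (I' K' : D) : wminor C Xmx I' K' = (minor I' K')%:M.
  by rewrite (rmorph_wminor (@scalar_mx A #|D|)).
have colL : column_relations C Lmx.
  have := rmorph_column_relations (map_mx (GRing.in_alg A)) (lop_column_relations n
    q_neq0).
  by rewrite /= map_scalar_mx.
have colX : column_relations C Xmx.
  by have := rmorph_column_relations (@scalar_mx A #|D|) colx.
have XL i j l m : Xmx l m * Lmx i j = Lmx i j * Xmx l m.
  apply/matrixP => a b; rewrite -[_ * _ in LHS]/(_ *m _) mul_scalar_mx.
  by rewrite -[_ * _ in RHS]/(_ *m _) -diag_const_mx mul_mx_diag !mxE /= mulr_algl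
    mulr_algr.
have := wminor_intertwine CC J I lop_intertwine.
rewrite (wminorM CC _ _ colL XL) (wminorM CC _ _ colX) => [|i j l m]; last by rewrite XL.
move=> /(congr1 (fun B : 'M[A]_#|D| => B (enum_rank M) (enum_rank N))).
rewrite mulr_suml mulr_sumr !summxE => E.
transitivity (\sum_K (wminor C Lmx I K * wminor C Xmx K J * T) (enum_rank M) (enum_rank
  N)).
  apply: eq_bigr => K _; rewrite -mulrA smx_mulE; apply: eq_bigr => P _.
  rewrite Lg Xg -[_%:M * _]/(_ *m _) mul_scalar_mx !mxE !enum_rankK /=.
  by rewrite mulr_algl.
rewrite {}E; apply: eq_bigr => K _; rewrite mulrA smx_mulE; apply: eq_bigr => P _.
rewrite Lg Xg -[_ * _%:M]/(_ *m _) -diag_const_mx mul_mx_diag !mxE !enum_rankK /=.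
by rewrite mulr_algr.
Qed.

End Braiding.

(** * Closed form of the coefficients *)

Section Counting.
Variable n : nat.
Implicit Types (S V U W : {set 'I_n}) (i j l t u v w : 'I_n).

Definition above S i := #|[set t in S | (i < t)%N]|.

Lemma ell_below S V : ell S V = (\sum_(i in S) below V i)%N.
Proof.
rewrite /ell -sum1dep_card.
rewrite (eq_bigl (fun p : 'I_n * 'I_n => (p.1 \in S) && ((p.2 \in V) && (p.2 <
  p.1)%N))) //.
rewrite -(pair_big_dep (mem S) (fun i t => (t \in V) && (t < i)%N) (fun _ _ => 1%N)) /=.
by apply: eq_bigr => i _; rewrite sum1dep_card.
Qed.

Lemma ell_above S V : ell S V = (\sum_(i in V) above S i)%N.
Proof.
rewrite ell_below; under eq_bigr do rewrite /below -sum1dep_card.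
rewrite (exchange_big_dep (fun t => t \in V)) /=; last by move=> ? ? _ /andP[].
apply: eq_bigr => t tV; rewrite sum1dep_card; apply: eq_card => i.
by rewrite !inE tV.
Qed.

Lemma above_between S i j : (i < j)%N -> j \notin S ->
  above S i = (between S i j + above S j)%N.
Proof.
move=> ij jS; rewrite /above /between -cardsUI [X in (_ + X)%N]eq_card0 ?addn0;
  last first.
  by move=> t; rewrite !inE; case: (t \in S); rewrite //=; lia.
apply: eq_card => t; rewrite !inE; have [tS|//] := boolP (t \in S).
have : t != j by apply: contraNneq jS => <-.
rewrite -val_eqE /=; lia.
Qed.

Lemma below_between_in S i j : i \in S -> (i < j)%N ->
  below S j = (below S i + between S i j).+1.
Proof.
move=> iS ij; rewrite (below_setD1 j iS) ij (below_between _ ij) ?setD11 //.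
by rewrite (below_setD1 i iS) (between_setD1 i j iS) ltnn.
Qed.

Lemma sum_below (R : nmodType) S (G : nat -> R) :
  \sum_(t in S) G (below S t) = \sum_(a < #|S|) G a.
Proof.
have [->|[i0 _]] := set_0Vmem S; first by rewrite big_set0 cards0 big_ord0.
rewrite -big_enum (big_nth i0) -cardE big_mkord; apply: eq_bigr => a _.
by rewrite below_nth.
Qed.

End Counting.

(** * Quantum integers and the factor [xi] *)

Section QuantumIntegers.
Variables (k : fieldType) (n : nat) (q : k).
Hypothesis q_neq0 : q != 0.

Let h := - q.
Let h_neq0 : h != 0. Proof. by rewrite oppr_eq0. Qed.

Lemma qintE d : qint q d = \sum_(i < d) h ^+ i / h ^+ (d.-1 - i).
Proof.
rewrite /qint (reindex_inj rev_ord_inj) /=; apply: eq_bigr => i _.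
case: d i => [[]//|d] i; rewrite subSS /=.
have -> : d.+1%:Z - 1 - (2 * (d - i))%N%:Z = i%:Z - (d - i)%N%:Z by have := ltn_ord i;
  lia.
by rewrite expfzDr // -exprnN.
Qed.

(** Since -[qhat] q = 1 - h^2, this is a telescoping geometric sum. *)
Lemma sum_qsquare d : - qhat q * q * (\sum_(i < d) h ^+ (2 * i)) + h ^+ (2 * d) = 1.
Proof.
elim: d => [|d IH]; first by rewrite big_ord0 mulr0 add0r.
rewrite big_ord_recr /= mulrDr -[RHS]IH -!addrA; congr (_ + _).
rewrite mulnS exprD /h /qhat; by field.
Qed.

(** Disjointness makes the bound v <= u strict, and the rank of [u] in [U] is [below U u]. *)
Lemma xiE (U V : {set 'I_n}) : [disjoint U & V] ->
  xi q U V = \prod_(u in U) qint q (below V u - below U u).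
Proof.
move=> dUV; rewrite /xi [RHS]big_enum_val; apply: eq_bigr => l _; congr (qint q (_ - _)).
  have UV : enum_val l \notin V by rewrite (disjointFr dUV) // enum_valP.
  apply: eq_card => v; rewrite !inE; have [vV|//] := boolP (v \in V).
  by rewrite /= leq_eqVlt; case: eqP => [/val_inj vl|//]; rewrite vl (negbTE UV) in vV.
by rewrite (enum_val_nth (enum_val l)) below_nth.
Qed.

Lemma xi_min (U V : {set 'I_n}) u : [disjoint U & V] ->
  u \in U -> (forall t, t \in U -> (u <= t)%N) ->
  xi q U V = qint q (below V u) *
    \prod_(t in U | t != u) qint q (below V t - below U t).
Proof.
move=> dUV uU umin; rewrite xiE // (bigD1 u) //=; congr (qint q _ * _).
rewrite [below U u]eq_card0 ?subn0 // => t; rewrite !inE.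
by apply/negP => /andP[/umin]; rewrite leqNgt => /negbTE->.
Qed.

(** Every remaining element exceeds both [u] and [v], so its two counts drop together. *)
Lemma xi_setD1 (U V : {set 'I_n}) u v : [disjoint U & V] ->
  u \in U -> (forall t, t \in U -> (u <= t)%N) -> v \in V -> (v < u)%N ->
  xi q (U :\ u) (V :\ v) =
    \prod_(t in U | t != u) qint q (below V t - below U t).
Proof.
move=> dUV uU umin vV vu; rewrite !xiE //; last first.
  by apply: disjointW dUV; apply: subD1set.
apply: eq_big => [t|t]; first by rewrite !inE andbC.
rewrite !inE => /andP[tu tU].
have ut : (u < t)%N by rewrite ltn_neqAle umin // andbT eq_sym val_eqE.
by rewrite (below_setD1 t vV) (below_setD1 t uU) ut (ltn_trans vu ut) !add1n subSS.
Qed.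

Lemma xi_move (U V : {set 'I_n}) u v : [disjoint U & V] -> u \notin U -> u \notin V ->
  (forall t, t \in U -> (u < t)%N) -> v \in V -> (v < u)%N ->
  xi q U (u |: V :\ v) = xi q U V.
Proof.
move=> dUV uU uV umin vV vu; rewrite !xiE //; last first.
  rewrite disjoint_subset; apply/subsetP => t tU;
    rewrite !inE (disjointFr dUV tU) andbF orbF.
  by apply: contraNneq uU => <-.
apply: eq_bigr => t tU; congr (qint q (_ - _)).
rewrite below_setU1 ?(below_setD1 t vV) ?umin ?(ltn_trans vu) ?umin //.
by rewrite !inE (negbTE uV) andbF.
Qed.

End QuantumIntegers.

(** * The recursion along the smallest column and its solution *)

Section ClosedForm.
Variables (k : fieldType) (n : nat) (q : k).
Hypothesis q_neq0 : q != 0.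
Implicit Types (M K I T : {set 'I_n}) (t u v m : 'I_n).

Let h := - q.
Let h_neq0 : h != 0. Proof. by rewrite oppr_eq0. Qed.

(** Equality of weights: each nonzero term of the expansion preserves it ([balanced_step]). *)
Definition balanced M K I T :=
  (#|M| == #|K|) && [forall t, ((t \in M) + (t \in I) == (t \in K) + (t \in T))%N].

(* This is [rcoef q M K I T] when the multisets M + I and K + T agree; then
   [K] is the set [natural I M T], and [W] is the first argument of [ell] in
   [Lexp T I M]. No condition T <= I is needed, as [xi] vanishes without it. *)
Definition rval M K I T : k :=
  let W := (T :\: K) :|: (M :\: I) in
  q^-1 ^+ #|I :&: M| * (- qhat q) ^+ #|I :\: T|
  * (h ^+ ell W (T :\: I) / h ^+ ell W (I :\: T))
  * xi q (I :\: T) (T :\: I).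

Lemma rcoef0 M I T : rcoef q M set0 I T = ((M == set0) && (T == I))%:R.
Proof.
rewrite /rcoef wminor0; case: (M == set0); last by rewrite mxE.
by rewrite mxE (inj_eq enum_rank_inj) eq_sym.
Qed.

Lemma rcoefU1 M u K I T : (forall t, t \in K -> (u < t)%N) ->
  rcoef q M (u |: K) I T = \sum_(m in M)
    h ^+ below M m * lcoef q m u I * rcoef q (M :\ m) K (shift m u I) T.
Proof.
move=> uK; rewrite /rcoef wminorU1 // summxE; apply: eq_bigr => m mM.
have -> : (- q)%:M ^+ below M m = (h ^+ below M m)%:M :> 'M[k]_#|{set 'I_n}|.
  by rewrite rmorphXn.
rewrite -mulrA -[_%:M * _]/(_ *m _) mul_scalar_mx mxE -mulrA; congr (_ * _).
rewrite smx_mulE (bigD1 (shift m u I)) //= big1 ?addr0 => [|P PI].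
  by rewrite smxE eqxx.
by rewrite smxE (negbTE PI) mul0r.
Qed.

Lemma balanced_step M u K I T m : u \notin K -> m \in M ->
  (m == u) || (m \notin I) && (u \in I) ->
  balanced (M :\ m) K (if m == u then I else m |: I :\ u) T =
  balanced M (u |: K) I T.
Proof.
move=> uK mM mu; rewrite /balanced (cardsD1 m M) mM cardsU1 uK eqn_add2l.
congr (_ && _); apply: eq_forallb => t.
case: (eqVneq m u) mu => [mu _|mu /= /andP[mI uI]].
  rewrite -mu in uK *; rewrite !inE; have [->|//] := eqVneq t m.
  by rewrite mM (negbTE uK) /=; case: (m \in I); case: (m \in T).
rewrite !inE; have [->|tm] /= := eqVneq t m.
  by rewrite (negbTE mu) mM (negbTE mI) addnC.
have [->|//] := eqVneq t u.
by rewrite uI (negbTE uK) /=; case: (u \in M); case: (u \in T).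
Qed.

Section Step.
Variables (M K I T : {set 'I_n}) (u : 'I_n).
Hypothesis uK : forall t, t \in K -> (u < t)%N.
Hypothesis bal : balanced M (u |: K) I T.

Let W := (T :\: (u |: K)) :|: (M :\: I).
Let U := I :\: T.
Let V := T :\: I.

Let count t : ((t \in M) + (t \in I) = (t \in u |: K) + (t \in T))%N.
Proof. by apply/eqP; move: t; apply/forallP; case/andP: bal. Qed.

Let unK : u \notin K. Proof. by apply/negP => /uK; rewrite ltnn. Qed.

Let countu : ((u \in M) + (u \in I) = 1 + (u \in T))%N.
Proof. by rewrite count setU11. Qed.

(** [u |: K] has no element below [u], so there balance forces [T] to be the disjoint union of [M]
    and [I]. *)
Let low t : (t < u)%N -> (t \in K = false) * ((t == u) = false) *
   (t \in M = (t \in T) && (t \notin I)).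
Proof.
move=> tu; have tK : (t \in K) = false by apply/negP => /uK; rewrite ltnNge ltnW.
have tnu : (t == u) = false by rewrite -val_eqE ltn_eqF.
split=> //; have := count t; rewrite !inE tK tnu.
by case: (t \in M); case: (t \in I); case: (t \in T).
Qed.

Let disjUV : [disjoint U & V].
Proof. by rewrite -setI_eq0; apply/eqP/setP => t; rewrite !inE; case: (t \in I);
  rewrite ?andbF. Qed.

Let Umin t : t \in U -> (u <= t)%N.
Proof.
rewrite leqNgt inE => /andP[tT tI]; apply/negP => /low lowt.
have := count t; rewrite !inE !lowt tI (negbTE tT) //.
Qed.

Let belowUu : below U u = 0%N.
Proof.
apply: eq_card0 => t; rewrite inE; apply/negP => /andP[/Umin ut].
by rewrite ltnNge ut.
Qed.

Let belowM v : (v <= u)%N -> below M v = below V v.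
Proof.
move=> vu; apply: eq_card => t; rewrite !inE.
have [tv|] := boolP (t < v)%N; last by rewrite !andbF.
by rewrite (low (leq_trans tv vu)) !andbT andbC.
Qed.

Lemma rval_diag_notin : u \in M -> u \notin I ->
  h ^+ below M u * rval (M :\ u) K I T = rval M (u |: K) I T.
Proof.
move=> uM uI.
have uT : u \in T = false by have := countu; rewrite uM (negbTE uI); case: (u \in T).
have -> : rval (M :\ u) K I T = q^-1 ^+ #|I :&: M| * (- qhat q) ^+ #|U|
    * (h ^+ ell (W :\ u) V / h ^+ ell (W :\ u) U) * xi q U V.
  rewrite /rval; have -> : I :&: (M :\ u) = I :&: M.
    by apply/setP => t; rewrite !inE; have [->|] := eqVneq t u; rewrite ?(negbTE uI).
  have -> // : (T :\: K) :|: ((M :\ u) :\: I) = W :\ u.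
  apply/setP => t; rewrite !inE; have [->|] //= := eqVneq t u.
  by rewrite uT !andbF.
have uW : u \in W by rewrite !inE uM uI orbT.
rewrite /rval -/W -/U -/V !(ell_below W) !(big_setD1 u uW) /= belowUu add0n.
by rewrite -!ell_below exprD -belowM //; ring.
Qed.

(** Deleting [u] from the rows and columns puts it into the first argument of [ell]. The count
    [below V u] thus occurs twice, from there and from the expansion. *)
Lemma rval_diag_in : u \in M -> u \in I ->
  h ^+ below M u * q^-1 * rval (M :\ u) K I T = h ^+ (2 * below V u) * rval M (u |: K)
    I T.
Proof.
move=> uM uI.
have uT : u \in T by have := countu; rewrite uM uI; case: (u \in T).
have cardIM : #|I :&: M| = #|I :&: (M :\ u)|.+1.
  rewrite (cardsD1 u) inE uI uM add1n; congr _.+1.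
  by apply: eq_card => t; rewrite !inE andbCA.
have -> : rval (M :\ u) K I T = q^-1 ^+ #|I :&: (M :\ u)| * (- qhat q) ^+ #|U|
    * (h ^+ ell (u |: W) V / h ^+ ell (u |: W) U) * xi q U V.
  rewrite /rval; have -> // : (T :\: K) :|: ((M :\ u) :\: I) = u |: W.
  apply/setP => t; rewrite !inE; have [->|] //= := eqVneq t u.
  by rewrite uT unK.
have uW : u \notin W by rewrite !inE eqxx uI.
rewrite /rval -/W -/U -/V cardIM !(ell_below (u |: _)) !(big_setU1 _ uW) /= belowUu add0n.
by rewrite -!ell_below exprD exprS mulnC exprM -belowM // expr2; ring.
Qed.

Section OffDiagonal.
Variable v : 'I_n.
Hypotheses (uI : u \in I) (vV : v \in V) (vu : (v < u)%N).

Let vTI : (v \in T) * ((v \in I) = false).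
Proof. by move: vV; rewrite inE => /andP[/negbTE ? ?]. Qed.

Let vnu : (v == u) = false. Proof. by rewrite -val_eqE ltn_eqF. Qed.

Let unW : u \notin W. Proof. by rewrite !inE eqxx uI. Qed.

(** Below [u], the set [W] coincides with [T], which there is the disjoint union of [I] and [V]. *)
Let betweenW : between W v u = (between I v u + between V v u)%N.
Proof.
rewrite /between -cardsUI [X in (_ + X)%N]eq_card0 ?addn0; last first.
  by move=> t; rewrite !inE; case: (t \in I); rewrite ?andbF.
apply: eq_card => t; rewrite !inE.
have [/andP[_ tu]|] := boolP (v < t < u)%N; last by rewrite !andbF.
have := count t; rewrite !inE !low // !andbT.
by case: (t \in I); case: (t \in T).
Qed.

(** The last factor is one monomial of the quantum integer of [below V u]: by [below_between_in],
    its two exponents add up to [(below V u).-1]. *)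
Lemma rval_off_notin : u \notin M ->
  h ^+ below M v * (- qhat q * h ^+ between I v u) * rval (M :\ v) K (v |: I :\ u) T =
  q^-1 ^+ #|I :&: M| * (- qhat q) ^+ #|U| * (h ^+ ell W V / h ^+ ell W U)
  * (\prod_(t in U | t != u) qint q (below V t - below U t))
  * (h ^+ below V v / h ^+ between V v u).
Proof.
move=> uM.
have uT : u \in T = false by have := countu; rewrite uI (negbTE uM); case: (u \in T).
have uU : u \in U by rewrite inE uI uT.
have cardU : #|U| = #|U :\ u|.+1 by rewrite (cardsD1 u) uU.
have -> : rval (M :\ v) K (v |: I :\ u) T = q^-1 ^+ #|I :&: M| * (- qhat q) ^+ #|U :\ u|
    * (h ^+ ell W (V :\ v) / h ^+ ell W (U :\ u)) * xi q (U :\ u) (V :\ v).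
  rewrite /rval.
  have -> : (v |: I :\ u) :&: (M :\ v) = I :&: M.
    apply/setP => t; rewrite !inE; have [->|tv] /= := eqVneq t v; first by rewrite !vTI.
    by have [->|] //= := eqVneq t u; rewrite (negbTE uM) andbF.
  have -> : (v |: I :\ u) :\: T = U :\ u.
    apply/setP => t; rewrite !inE; have [->|tv] /= := eqVneq t v;
      first by rewrite !vTI vnu.
    by rewrite andbCA.
  have -> : T :\: (v |: I :\ u) = V :\ v.
    apply/setP => t; rewrite !inE negb_or; have [->|] //= := eqVneq t v.
    by have [->|] //= := eqVneq t u; rewrite uT andbF.
  have -> // : (T :\: K) :|: ((M :\ v) :\: (v |: I :\ u)) = W.
  apply/setP => t; rewrite !inE; have [->|tv] /= := eqVneq t v.
    by rewrite vnu !low // !vTI.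
  by have [->|] //= := eqVneq t u; rewrite uT uI (negbTE uM) !andbF.
rewrite (xi_setD1 q disjUV uU Umin vV vu) cardU.
rewrite !(ell_above W) (big_setD1 u uU) (big_setD1 v vV) /= -!ell_above.
rewrite (above_between vu unW) betweenW belowM ?(ltnW vu) // !exprD exprS.
by field; rewrite !expf_neq0.
Qed.

Lemma rval_off_in : u \in M ->
  h ^+ below M v * (- qhat q * h ^+ between I v u) * rval (M :\ v) K (v |: I :\ u) T =
  - qhat q * q * h ^+ (2 * below V v) * rval M (u |: K) I T.
Proof.
move=> uM.
have uT : u \in T by have := countu; rewrite uI uM; case: (u \in T).
have uU : u \notin U by rewrite inE uT.
have unV : u \notin V by rewrite inE uI.
have cardIM : #|I :&: M| = #|(I :&: M) :\ u|.+1 by rewrite (cardsD1 u) inE uI uM.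
have -> : rval (M :\ v) K (v |: I :\ u) T = q^-1 ^+ #|(I :&: M) :\ u| * (- qhat q) ^+ #|U|
    * (h ^+ ell (u |: W) (u |: V :\ v) / h ^+ ell (u |: W) U) * xi q U (u |: V :\ v).
  rewrite /rval.
  have -> : (v |: I :\ u) :&: (M :\ v) = (I :&: M) :\ u.
    apply/setP => t; rewrite !inE; have [->|tv] /= := eqVneq t v;
      first by rewrite !vTI andbF.
    by rewrite andbA.
  have -> : (v |: I :\ u) :\: T = U.
    apply/setP => t; rewrite !inE; have [->|tv] /= := eqVneq t v; first by rewrite !vTI.
    by have [->|] //= := eqVneq t u; rewrite uT.
  have -> : T :\: (v |: I :\ u) = u |: V :\ v.
    apply/setP => t; rewrite !inE negb_or; have [->|] /= := eqVneq t v;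
      first by rewrite vnu.
    by have [->|] //= := eqVneq t u; rewrite uT.
  have -> // : (T :\: K) :|: ((M :\ v) :\: (v |: I :\ u)) = u |: W.
  apply/setP => t; rewrite !inE; have [->|tv] /= := eqVneq t v.
    by rewrite vnu !low // !vTI.
  by have [->|] //= := eqVneq t u; rewrite uT unK.
rewrite xi_move // => [|t tU]; last first.
  by rewrite ltn_neqAle Umin // andbT; apply: contraNneq uU => /val_inj->.
rewrite /rval -/W -/U -/V cardIM.
have unVv : u \notin V :\ v by rewrite inE (negbTE unV) andbF.
rewrite !(ell_below (u |: _)) !(big_setU1 _ unW) /= belowUu add0n -!ell_below.
rewrite below_setU1 // ltnn add0n !(ell_above W V) (big_setD1 v vV) /= -ell_above.
rewrite (ell_above W (u |: _)) (big_setU1 _ unVv) /= -ell_above.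
rewrite (above_between vu unW) betweenW belowM ?(ltnW vu) //.
have : below V u = (below V v + between V v u).+1 by apply: below_between_in.
rewrite (below_setD1 u vV) vu add1n => -[->].
rewrite mulnC exprM !exprD !exprS.
field; rewrite ?expf_neq0 //.
Qed.

End OffDiagonal.

Lemma sum_below_lt (G : nat -> k) :
  \sum_(v in V | (v < u)%N) G (below V v) = \sum_(a < below V u) G a.
Proof.
rewrite -(sum_below [set v in V | (v < u)%N]).
apply: eq_big => [v|v /andP[_ vu]]; first by rewrite !inE.
congr G; apply: eq_card => t; rewrite !inE.
by have [tv|_] := boolP (t < v)%N; rewrite ?andbF // (ltn_trans tv vu) !andbT.
Qed.

(* If [u] lies in all four sets, the terms m < u telescope against m = u; if
   [u] lies in I and K only, they add up to [d]_{-q} for the smallest element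
   [u] of I \ T. *)
Lemma rval_recursion :
  \sum_(m in M) h ^+ below M m * lcoef q m u I * rval (M :\ m) K (shift m u I) T =
  rval M (u |: K) I T.
Proof.
rewrite (bigID (fun m : 'I_n => (m < u)%N)) /=.
have -> : \sum_(m in M | ~~ (m < u)%N)
    h ^+ below M m * lcoef q m u I * rval (M :\ m) K (shift m u I) T =
    if u \in M then h ^+ below M u * q^-1 ^+ (u \in I) * rval (M :\ u) K I T else 0.
  have [uM|uM] := boolP (u \in M).
    rewrite (bigD1 u) ?uM ?ltnn //= lcoef_diag shift_diag big1 ?addr0 // => m.
    rewrite -leqNgt => /andP[/andP[_ um] mu].
    by rewrite lcoef_gt ?mulr0 ?mul0r // ltn_neqAle um andbT eq_sym val_eqE.
  apply: big1 => m /andP[mM]; rewrite -leqNgt => um.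
  rewrite lcoef_gt ?mulr0 ?mul0r // ltn_neqAle um andbT.
  by apply: contraNneq uM => /val_inj->.
have [uI|uI] := boolP (u \in I); last first.
  rewrite big1 ?add0r => [|m /andP[mM mu]].
    have uM : u \in M by have := countu; rewrite (negbTE uI); case: (u \in M);
      case: (u \in T).
    by rewrite uM expr0 mulr1 rval_diag_notin.
  by rewrite lcoef_lt // (negbTE uI) andbF mulr0 mul0r.
have -> : \sum_(m in M | (m < u)%N)
    h ^+ below M m * lcoef q m u I * rval (M :\ m) K (shift m u I) T =
  \sum_(v in V | (v < u)%N)
    h ^+ below M v * (- qhat q * h ^+ between I v u) * rval (M :\ v) K (v |: I :\ u) T.
  apply: eq_big => [m|m /andP[mM mu]].
    by have [mu|_] := boolP (m < u)%N; rewrite ?andbF // !inE !low // !andbT andbC.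
  by rewrite lcoef_lt // shift_lt // uI; move: mM; rewrite low // => /andP[_ ->].
have [uM|uM] := boolP (u \in M).
  rewrite expr1 rval_diag_in //.
  rewrite (eq_bigr (fun v => - qhat q * q * h ^+ (2 * below V v) * rval M (u |: K) I
    T)); last first.
    by move=> v /andP[vV vu]; apply: rval_off_in.
  rewrite -mulr_suml -mulr_sumr (sum_below_lt (fun a => h ^+ (2 * a))) -mulrDl.
  by rewrite sum_qsquare // mul1r.
have uT : u \in T = false by have := countu; rewrite uI (negbTE uM); case: (u \in T).
have uU : u \in U by rewrite inE uI uT.
rewrite addr0 [RHS]/rval -/W -/U -/V (xi_min q disjUV uU Umin).
have -> : qint q (below V u) = \sum_(v in V | (v < u)%N) h ^+ below V v / h ^+ between
  V v u.
  rewrite qintE // -(sum_below_lt (fun a => h ^+ a / h ^+ ((below V u).-1 - a))).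
  apply: eq_bigr => v /andP[vV vu].
  by rewrite (below_between_in vV vu) /= addKn.
rewrite [X in _ * X]mulrC [RHS]mulrA mulr_sumr; apply: eq_bigr => v /andP[vV vu].
exact: rval_off_notin.
Qed.

End Step.

Lemma rcoefE M K I T : rcoef q M K I T = if balanced M K I T then rval M K I T else 0.
Proof.
elim/set_min_ind: K M I T => [|u K uK IH] M I T.
  rewrite rcoef0 /balanced cards0 cards_eq0.
  have [->|//] := eqVneq M set0; rewrite /=.
  have -> : [forall t, ((t \in set0) + (t \in I) == (t \in set0) + (t \in T))%N] = (T
    == I).
    apply/forallP/eqP => [bal|-> t]; last by [].
    by apply/setP => t; have := bal t; rewrite !inE; do 2 case: (t \in _).
  have [->|//] := eqVneq T I.
  have ell0 S : ell S (set0 : {set 'I_n}) = 0%N by rewrite ell_above big_set0.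
  rewrite /rval setI0 !setDv cards0 !ell0 xiE //; last by rewrite -setI_eq0 setI0.
  by rewrite big_set0 !expr0 divr1 !mulr1.
rewrite rcoefU1 //.
have unK : u \notin K by apply/negP => /uK; rewrite ltnn.
transitivity (\sum_(m in M) if balanced M (u |: K) I T then
    h ^+ below M m * lcoef q m u I * rval (M :\ m) K (shift m u I) T else 0).
  apply: eq_bigr => m mM; rewrite IH.
  have [mu|um|/val_inj mu] := ltngtP m u.
  - have mneu : (m == u) = false by rewrite -val_eqE ltn_eqF.
    have [miu|miu] := boolP ((m \notin I) && (u \in I)); last first.
      by rewrite lcoef_lt // (negbTE miu) mulr0 !mul0r if_same.
    have := @balanced_step M u K I T m unK mM; rewrite mneu miu => /(_ isT).
    by rewrite shift_lt // => ->; case: ifP; rewrite ?mulr0.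
  - by rewrite lcoef_gt // mulr0 !mul0r if_same.
  - have := @balanced_step M u K I T m unK mM; rewrite mu eqxx => /(_ isT).
    by rewrite shift_diag => ->; case: ifP; rewrite ?mulr0.
have [bal|_] := boolP (balanced M (u |: K) I T); last by rewrite big1.
exact: rval_recursion.
Qed.

End ClosedForm.

(** * Identification with the index sets of the statement *)

Section Natural.
Variable n : nat.
Implicit Types (X Y S K I T : {set 'I_n}).

Definition intermediate X Y S :=
  [&& S \subset X :|: Y, X :&: Y \subset S & #|S| == #|X|].

(** Balance determines [K] from the other three sets, which is where the sets [natural] of the
    statement come from. *)
Lemma natural_eqP X Y S K :
  [forall t, ((t \in K) + (t \in S) == (t \in X) + (t \in Y))%N] && (#|K| == #|Y|) =
  intermediate X Y S && (K == natural X Y S).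
Proof.
have cards : (forall t, ((t \in K) + (t \in S) = (t \in X) + (t \in Y))%N) ->
    (#|K| + #|S| = #|X| + #|Y|)%N.
  move=> bal; rewrite -(cardsUI K S) -(cardsUI X Y); congr (_ + _)%N;
    apply: eq_card => t; rewrite !inE;
    by have := bal t; case: (t \in K); case: (t \in S); case: (t \in X); case: (t \in Y).
apply/idP/idP => [/andP[/forallP bal /eqP cardKY]|/andP[/and3P[SU IS /eqP cardS] /eqP
  KE]].
  have {}bal t := eqP (bal t).
  apply/andP; split; last by apply/eqP/setP => t; have := bal t; rewrite !inE;
    case: (t \in K); case: (t \in S); case: (t \in X); case: (t \in Y).
  apply/and3P; split; try by (apply/subsetP => t; have := bal t; rewrite !inE;
    case: (t \in K); case: (t \in S); case: (t \in X); case: (t \in Y)).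
  by rewrite -(eqn_add2l #|K|) (cards bal) cardKY addnC.
have bal t : ((t \in K) + (t \in S) = (t \in X) + (t \in Y))%N.
  have := subsetP SU t; have := subsetP IS t; rewrite KE !inE.
  by case: (t \in S); case: (t \in X); case: (t \in Y) => //= a b;
    first [have := a isT | have := b isT].
apply/andP; split; first by apply/forallP => t; rewrite bal.
by rewrite -(eqn_add2r #|S|) (cards bal) cardS addnC.
Qed.

Definition upto S (i : 'I_n) := #|[set t in S | (t <= i)%N]|.

(** If the l-th element t of [T] exceeded the l-th element i of [I], counting l from 0, then [T]
    would have at most l elements up to i, whereas [I] has at least l + 1. *)
Lemma ile_upto T I : #|T| = #|I| -> (forall i, (upto I i <= upto T i)%N) -> ile T I.
Proof.
move=> cardTI leTI; rewrite /ile all2E -!cardE cardTI eqxx /=.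
have [->|[i0 _]] := set_0Vmem T; first by rewrite enum_set0; case: (enum _).
apply/(all_nthP (i0, i0)) => l; rewrite size_zip -!cardE cardTI minnn => lI.
rewrite nth_zip /= -?cardE //; set t := nth _ _ l; set i := nth _ _ l.
rewrite leqNgt; apply/negP => it.
have : (upto T i <= below T t)%N.
  apply/subset_leq_card/subsetP => s; rewrite !inE => /andP[-> si].
  exact: leq_ltn_trans si it.
rewrite below_nth ?cardTI // leqNgt => /negP; apply.
apply: leq_trans (leTI i); rewrite /upto (cardsD1 i) inE -mem_enum mem_nth -?cardE //
  leqnn ltnS.
rewrite -[X in (X <= _)%N](below_nth i0 lI) -/i; apply/subset_leq_card/subsetP => s.
rewrite !inE -val_eqE /= => /andP[sI si].
by rewrite ltn_eqF //= sI ltnW.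
Qed.

End Natural.

Section XiVanishing.
Variables (k : fieldType) (n : nat) (q : k).
Implicit Types (X Y S K I T : {set 'I_n}).

(** If [xi] is nonzero, no factor is [0], so each [u] in [I :\: T] has more predecessors in
    [T :\: I] than in [I :\: T]; this gives the criterion of [ile_upto]. Only [0] = 0 is used, since
    [d] may vanish for other d. *)
Lemma xi_not_ile T I : #|T| = #|I| -> ~~ ile T I -> xi q (I :\: T) (T :\: I) = 0.
Proof.
move=> cardTI; apply: contraNeq => xi_neq0.
have disj : [disjoint I :\: T & T :\: I].
  by rewrite -setI_eq0; apply/eqP/setP => t; rewrite !inE; case: (t \in I);
    rewrite ?andbF.
rewrite xiE // in xi_neq0.
have d_gt0 u : u \in I :\: T -> (below (I :\: T) u < below (T :\: I) u)%N.
  move=> uU; rewrite ltnNge -subn_eq0; apply/negP => /eqP d0.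
  case/eqP: xi_neq0; rewrite (bigD1 u) //= d0.
  by rewrite [qint _ _]big_ord0 mul0r.
apply: ile_upto => // i.
have split_upto (A B : {set 'I_n}) : upto A i = (upto (A :&: B) i + upto (A :\: B) i)%N.
  rewrite /upto -(cardsID B); congr (_ + _)%N; apply: eq_card => t; rewrite !inE.
    by rewrite andbAC.
  by rewrite andbA.
rewrite (split_upto I T) (split_upto T I) [T :&: I]setIC leq_add2l.
have [U0|[u0 u0U]] := set_0Vmem [set u in I :\: T | (u <= i)%N].
  by rewrite {1}/upto U0 cards0.
(* The largest element of [I :\: T] up to [i] controls both counts at [i]. *)
have [u uU umax] : exists2 u, u \in [set u in I :\: T | (u <= i)%N] &
    forall t, t \in [set u in I :\: T | (u <= i)%N] -> (t <= u)%N.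
  by case: (arg_maxnP (fun i : 'I_n => i : nat) u0U) => u; exists u.
move: uU; rewrite inE => /andP[uU ui].
have leU : (upto (I :\: T) i <= (below (I :\: T) u).+1)%N.
  rewrite /upto (cardsD1 u) inE uU ui ltnS; apply/subset_leq_card/subsetP => t.
  rewrite inE in_set1 => /andP[tu /[dup] tU /umax]; move: tU;
    rewrite inE [in X in _ -> X]inE => /andP[-> _].
  by rewrite leq_eqVlt val_eqE (negbTE tu).
apply: leq_trans leU (leq_trans (d_gt0 u uU) _).
apply/subset_leq_card/subsetP => t; rewrite !inE => /andP[-> tu].
exact: leq_trans (ltnW tu) ui.
Qed.

End XiVanishing.
Section Assembly.
Variables (k : fieldType) (n : nat) (q : k).
Hypothesis q_neq0 : q != 0.
Implicit Types (X Y S K I J M N T : {set 'I_n}).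

Let h_neq0 : - q != 0. Proof. by rewrite oppr_eq0. Qed.

Lemma rval_not_ile M K I T : #|T| = #|I| -> ~~ ile T I -> rval q M K I T = 0.
Proof. by move=> cardTI TI; rewrite /rval xi_not_ile // mulr0. Qed.

Lemma natural_id X Y : natural X Y X = Y.
Proof. by apply/setP => t; rewrite !inE; case: (t \in X); case: (t \in Y). Qed.

Lemma intermediate_id X Y : intermediate X Y X.
Proof. by rewrite /intermediate subsetUl subsetIl eqxx. Qed.

Lemma rval_id M I : rval q M M I I = q^-1 ^+ #|I :&: M|.
Proof.
have ell0 S : ell S (set0 : {set 'I_n}) = 0%N by rewrite ell_above big_set0.
rewrite /rval !setDv cards0 !ell0 xiE // ?big_set0 ?divr1 ?mulr1 //.
by rewrite -setI_eq0 setI0.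
Qed.

Let exprz_oppB (a b : nat) : (- q) ^ (- (a%:Z - b%:Z)) = (- q) ^+ b / (- q) ^+ a.
Proof. by rewrite opprB expfzDr // -exprnN. Qed.

Lemma rval_lambda I M T : rval q M (natural I M T) I T =
  q^-1 ^+ #|I :&: M| * lambda_coef q I M T.
Proof.
by rewrite /rval /lambda_coef /Lexp exprz_oppB -!mulrA.
Qed.

(** The closed form with [S] and [J] in the places of [I] and [T]: its set W becomes the first
    argument of [ell] in [Lexp_nat]. *)
Lemma rval_mu J N S : intermediate J N S -> rval q (natural J N S) N S J =
  q^-1 ^+ #|J :&: N| * mu_coef q J N S.
Proof.
case/and3P => _ IS _.
rewrite /rval /mu_coef /Lexp_nat; have -> : S :&: natural J N S = J :&: N.
  apply/setP => t; have := subsetP IS t; rewrite !inE.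
  by case: (t \in J); case: (t \in N); case: (t \in S) => //= /(_ isT).
by rewrite [J :\: N :|: _]setUC exprz_oppB -!mulrA.
Qed.

Lemma balancedE1 M K I T : balanced M K I T = intermediate I M T && (K == natural I M T).
Proof.
rewrite -natural_eqP /balanced andbC eq_sym; congr (_ && _).
by apply: eq_forallb => t; rewrite eq_sym [(_ + (t \in I))%N]addnC.
Qed.

Lemma balancedE2 K N S J : balanced K N S J = intermediate J N S && (K == natural J N S).
Proof.
rewrite -natural_eqP /balanced andbC; congr (_ && _).
by apply: eq_forallb => t; rewrite [((t \in N) + _)%N]addnC.
Qed.

Lemma sum_natural (V : lmodType k) (b : pred {set 'I_n}) (r : {set 'I_n} -> {set 'I_n}
  -> k)
    (g : {set 'I_n} -> {set 'I_n}) (F : {set 'I_n} -> {set 'I_n} -> V) :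
  \sum_K \sum_T (if b T && (K == g T) then r K T else 0) *: F K T =
  \sum_(T | b T) r (g T) T *: F (g T) T.
Proof.
rewrite exchange_big [RHS]big_mkcond; apply: eq_bigr => T _.
rewrite (bigD1 (g T)) //= eqxx andbT big1 ?addr0 => [|K KT].
  by case: ifP => // _; rewrite scale0r.
by rewrite (negbTE KT) andbF scale0r.
Qed.

(** The term T = I has the scalar factored out here; terms without T <= I vanish by [rval_not_ile],
    leaving [lt_sets]. *)
Lemma sum_rcoef_lambda (V : lmodType k) (F : {set 'I_n} -> {set 'I_n} -> V) I M :
  \sum_K \sum_T rcoef q M K I T *: F K T = q^-1 ^+ #|I :&: M| *:
    (F M I + \sum_(T in lt_sets I M) lambda_coef q I M T *: F (natural I M T) T).
Proof.
under eq_bigr do under eq_bigr do rewrite rcoefE // balancedE1.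
rewrite (sum_natural (intermediate I M) (fun K T => rval q M K I T)).
rewrite (bigD1 I) ?intermediate_id //= natural_id rval_id scalerDr; congr (_ + _).
rewrite (bigID (fun T => ile T I)) /= [X in _ + X]big1 ?addr0; last first.
  move=> T /andP[/andP[/and3P[_ _ /eqP cardT] _] TI].
  by rewrite rval_not_ile // scale0r.
rewrite scaler_sumr; apply: eq_big => [T|T _]; last by rewrite rval_lambda scalerA.
by rewrite inE /ilt /intermediate -!andbA; congr [&& _, _, _ & _]; rewrite andbC.
Qed.

Lemma sum_rcoef_mu (V : lmodType k) (F : {set 'I_n} -> {set 'I_n} -> V) J N :
  \sum_K \sum_S rcoef q K N S J *: F K S = q^-1 ^+ #|J :&: N| *:
    (F N J + \sum_(S in gt_sets J N) mu_coef q J N S *: F (natural J N S) S).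
Proof.
under eq_bigr do under eq_bigr do rewrite rcoefE // balancedE2.
rewrite (sum_natural (intermediate J N) (fun K S => rval q K N S J)).
rewrite (bigD1 J) ?intermediate_id //= natural_id rval_id scalerDr; congr (_ + _).
rewrite (bigID (fun S => ile J S)) /= [X in _ + X]big1 ?addr0; last first.
  move=> S /andP[/andP[/and3P[_ _ /eqP cardS] _] JS].
  by rewrite rval_not_ile // scale0r.
rewrite scaler_sumr; apply: eq_big => [S|S /andP[/andP[intS _] _]].
  by rewrite inE /ilt /intermediate -!andbA; congr [&& _, _, _ & _]; rewrite andbC eq_sym.
by rewrite rval_mu // scalerA.
Qed.

End Assembly.

Lemma oqX_relations (k : fieldType) n (q : k) : qmatrix_relations q (@oqX k n q).
Proof.
split=> *; [exact: oqX_col | exact: oqX_row | exact: oqX_comm |].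
by apply/eqP; rewrite addrC -subr_eq; apply/eqP/oqX_cross.
Qed.

Theorem corollary5p8 (k : fieldType) (n : nat) (q : k)
    (n_gt0 : (0 < n)%N) (q_neq0 : q != 0)
    (I J M N : {set 'I_n}) (cardIJ : #|I| = #|J|) (cardMN : #|M| = #|N|) :
  q ^+ #|I :&: M| *: (qminor q I J * qminor q M N)
  + q ^+ #|I :&: M| *:
      (\sum_(S in gt_sets J N)
         mu_coef q J N S *: (qminor q I S * qminor q M (natural J N S)))
  = q ^+ #|J :&: N| *: (qminor q M N * qminor q I J)
  + q ^+ #|J :&: N| *:
      (\sum_(T in lt_sets I M)
         lambda_coef q I M T *: (qminor q (natural I M T) N * qminor q T J)).
Proof.
pose minor := wminor (- q)%:A (@oqX k n q).
have card_natural (X Y S : {set 'I_n}) : intermediate X Y S -> #|natural X Y S| = #|Y|.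
  move=> intS; have := natural_eqP X Y S (natural X Y S).
  by rewrite intS eqxx => /andP[_ /eqP].
have sum_mu : \sum_(S in gt_sets J N)
      mu_coef q J N S *: (qminor q I S * qminor q M (natural J N S)) =
    \sum_(S in gt_sets J N) mu_coef q J N S *: (minor I S * minor M (natural J N S)).
  apply: eq_bigr => S; rewrite inE => /and4P[SU IS cardS _].
  have intS : intermediate J N S by apply/and3P.
  by rewrite !qminorE ?(card_natural J N S) // cardIJ (eqP cardS).
have sum_lambda : \sum_(T in lt_sets I M)
      lambda_coef q I M T *: (qminor q (natural I M T) N * qminor q T J) =
    \sum_(T in lt_sets I M) lambda_coef q I M T *: (minor (natural I M T) N * minor T J).
  apply: eq_bigr => T; rewrite inE => /and4P[TU IT cardT _].
  have intT : intermediate I M T by apply/and3P.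
  by rewrite !qminorE ?(card_natural I M T) // (eqP cardT).
rewrite sum_mu sum_lambda !qminorE // -!scalerDr.
(* [M|N] is the minor expanded by Cauchy-Binet, and (I, J) is the matrix entry taken. *)
have := wminor_exchange q_neq0 (@oqX_relations k n q) M N I J.
rewrite (sum_rcoef_lambda q_neq0 (fun K T => minor K N * minor T J)).
rewrite (sum_rcoef_mu q_neq0 (fun K S => minor I S * minor M K)).
(* Each of the two powers cancels the leading scalar of one side and remains on the other. *)
move=> /(congr1 (fun y => q ^+ #|I :&: M| *: (q ^+ #|J :&: N| *: y))).
rewrite !scalerA.
have qK r : q ^+ r * q^-1 ^+ r = 1 by rewrite -exprMn divff ?expr1n.
by rewrite mulrAC qK mul1r -mulrA qK mulr1 => ->.
Qed.
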